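(* Let $n\ge2$, $I=[n]$, and let $W_{\mathrm{af}}$ be the affine Weyl group of type $C_n^{(1)}$. Let $J\subset I$. For $x,y\in(W^J)_{\mathrm{af}}$, we have $x\preceq y$ in $(W^J)_{\mathrm{af}}$ (semi-infinite Bruhat order) if and only if $\mathcal Y_i^{C_n}(x)\preceq\mathcal Y_i^{C_n}(y)$ in $\mathrm{CST}_{C_n}(\varpi_i)\times\mathbb{Z}$ for all $i\in I\setminus J$.
   Context: Write $[k]=\{1,\dots,k\}$ ($=\emptyset$ if $k\le0$). Let $\varepsilon_1,\dots,\varepsilon_n$ be an orthonormal basis of $\mathbb{R}^n$, $\Delta=\{\pm(\varepsilon_s\pm\varepsilon_t)\mid s<t\}\sqcup\{\pm2\varepsilon_s\}$ (type $C_n$), simple roots $\alpha_s=\varepsilon_s-\varepsilon_{s+1}$ ($s\le n-1$), $\alpha_n=2\varepsilon_n$; the coroot of $\gamma$ is $2\gamma/(\gamma,\gamma)$. $Q^\vee=\bigoplus_{i\in I}\mathbb{Z}\alpha_i^\vee$ and $c_i(\xi)$ is the coefficient of $\alpha_i^\vee$ in $\xi$. Let $\mathcal C_n=\{1\prec2\prec\cdots\prec n\prec\overline n\prec\cdots\prec\overline2\prec\overline1\}$ with involution $\sigma:s\leftrightarrow\overline s$ and $\|s\|=\|\overline s\|=s$. Identify $s=\varepsilon_s$, $\overline s=-\varepsilon_s$; then $W=\{w\in\mathfrak S(\mathcal C_n)\mid w\sigma=\sigma w\}$. $W_{\mathrm{af}}=W\ltimes\{t_\xi\mid\xi\in Q^\vee\}$,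 $\Delta_{\mathrm{af}}=\{\alpha+m\delta\}$, $\Delta^+_{\mathrm{af}}=\Delta^+\sqcup\{\alpha+m\delta\mid\alpha\in\Delta,m>0\}$, $wt_\xi(\alpha+m\delta)=w\alpha+(m-\langle\xi,\alpha\rangle)\delta$, $r_{\alpha+m\delta}=r_\alpha t_{m\alpha^\vee}$. For $J\subset I$, with $\Delta_J=\Delta\cap\bigoplus_{j\in J}\mathbb{Z}\alpha_j$: $(W^J)_{\mathrm{af}}=\{x\in W_{\mathrm{af}}\mid x\beta\in\Delta^+_{\mathrm{af}}\ \forall\beta\in(\Delta_J\cap\Delta^+)\sqcup\{\alpha+m\delta\mid\alpha\in\Delta_J,m>0\}\}$. With $\ell^{\frac{\infty}{2}}(wt_\xi)=\ell(w)+2\langle\xi,\rho\rangle$, $\rho=\frac12\sum_{\alpha\in\Delta^+}\alpha$, the semi-infinite Bruhat order on $(W^J)_{\mathrm{af}}$ is the partial order generated by $x\prec r_\beta x$ for $\beta\in\Delta^+_{\mathrm{af}}$, $x,r_\beta x\in(W^J)_{\mathrm{af}}$, $\ell^{\frac{\infty}{2}}(r_\beta x)=\ell^{\frac{\infty}{2}}(x)+1$. $\mathrm{CST}_{C_n}(\varpi_i)$ is the set of $i$-element subsets $\mathsf T=\{\mathsf T(1)\prec\cdots\prec\mathsf T(i)\}\subset\mathcal C_n$ with $\|\mathsf T(u)\|$ all distinct; $\mathsf T^{(i)}_w=\{w(1),\dots,w(i)\}$; $\mathcal Y_i^{C_n}(wt_\xi)=(\mathsf T^{(i)}_w,c_i(\xi))$.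 Order: $(\mathsf T,c)\preceq(\mathsf T',c')$ iff $c\le c'$ and $\mathsf T(u)\preceq\mathsf T'(u+c'-c)$ in $\mathcal C_n$ for all $u\in[i-c'+c]$. *)

(* Defs.v *)
From HB Require Import structures.
From mathcomp Require Import all_boot all_order all_fingroup all_algebra.
From mathcomp Require Import reals.
From Stdlib Require Import Relation_Operators.

Set Implicit Arguments.
Unset Strict Implicit.
Unset Printing Implicit Defensive.

Import Order.TTheory GRing.Theory Num.Theory.
Local Open Scope ring_scope.

(** Indices are shifted: the element i of I = [n] is the ordinal of value i-1
    in 'I_n. *)

(** The chain 1 < .. < n < n' < .. < 1' (primes are bars) is 'I_(n + n) with its
    usual order: s is the ordinal s-1 and s' is the ordinal 2n-s, so that the
    involution s <-> s' is rev_ord. *)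
Notation Cn n := 'I_(n + n)%N.

Definition Cnorm (n : nat) (c : Cn n) : nat := (minn c (rev_ord c)).+1.

(** The Weyl group; note that the product of {perm _} in MathComp is composition
    from left to right, i.e. w o v is (v * w)%g. *)
Definition weyl (n : nat) : {set {perm Cn n}} :=
  [set w : {perm Cn n} | [forall c : Cn n, w (rev_ord c) == rev_ord (w c)]].

Section RootSystem.
Variables (R : realType) (n : nat).
Local Notation V := 'rV[R]_n.

(** [eps s] is the (s+1)-th vector of the orthonormal basis. *)
Definition eps (s : nat) : V := \row_(j < n) (j == s :> nat)%:R.

Definition dot (u v : V) : R := \sum_(s < n) u 0 s * v 0 s.

Definition roots : seq V :=
  [seq a | p : 'I_n * 'I_n <- enum [set p : 'I_n * 'I_n | (p.1 < p.2)%N],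
           a : V <- [:: eps p.1 + eps p.2; eps p.1 - eps p.2;
                        - (eps p.1 + eps p.2); - (eps p.1 - eps p.2)]]
  ++ [seq a | s : 'I_n <- enum 'I_n, a : V <- [:: 2 *: eps s; - (2 *: eps s)]].

Definition coroot (a : V) : V := (2 / dot a a) *: a.

Definition simple_root (i : 'I_n) : V :=
  if (i.+1 < n)%N then eps i - eps i.+1 else 2 *: eps i.

Definition simple_roots : n.-tuple V := [tuple simple_root i | i < n].

Definition simple_coroots : n.-tuple V :=
  [tuple coroot (simple_root i) | i < n].

(** Roots have integer coordinates in the basis of simple roots, so only signs
    have to be tested. *)
Definition pos_roots : seq V :=
  [seq a <- roots | [forall i, 0 <= coord simple_roots i a]].

Definition rho : V := 2^-1 *: \sum_(a <- pos_roots) a.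

Definition rootsJ (J : {set 'I_n}) (a : V) : Prop :=
  a \in roots /\
  exists c : 'I_n -> int, a = \sum_(j in J) (c j)%:~R *: simple_root j.

Definition coroot_lattice (xi : V) : Prop :=
  exists c : 'I_n -> int,
    xi = \sum_(i < n) (c i)%:~R *: coroot (simple_root i).

(** The coordinate is an integer when xi is in the coroot lattice; the floor only
    serves to land in [int]. *)
Definition coroot_coef (i : 'I_n) (xi : V) : int :=
  Num.floor (coord simple_coroots i xi).

(** The identification of s with eps_s and of s' with - eps_s. *)
Definition Cvec (c : Cn n) : V :=
  if (c < n)%N then eps c else - eps (rev_ord c).

(** The linear action of the Weyl group on V. *)
Definition act (w : {perm Cn n}) (v : V) : V :=
  \sum_(s < n) v 0 s *: Cvec (w (lshift n s)).

Definition reflV (a v : V) : V := v - dot (coroot a) v *: a.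

(** The reflection r_a as a permutation of [Cn n]: since [Cvec] is injective
    there is a unique such permutation when [a] is a root. *)
Definition refl (a : V) : {perm Cn n} :=
  odflt 1%g [pick w : {perm Cn n} |
               [forall c, Cvec (w c) == reflV a (Cvec c)]].

(** The least length of a word in the simple reflections with product [w]; the
    bound on the search is harmless, because the partial products of a shortest
    word are pairwise distinct. *)
Definition weyl_length (w : {perm Cn n}) : nat :=
  find (fun k => [exists t : k.-tuple 'I_n,
                    w == (\prod_(i <- t) refl (simple_root i))%g])
       (iota 0 #|{perm Cn n}|).

(** [(w, xi)] stands for w t_xi, and [(a, m)] for a + m delta. *)
Definition affW : Type := ({perm Cn n} * V)%type.
Definition affV : Type := (V * R)%type.

Definition in_Waf (x : affW) : Prop := x.1 \in weyl n /\ coroot_lattice x.2.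

(** (w t_xi) (v t_zeta) = w v t_(v^-1 xi + zeta) *)
Definition affM (x y : affW) : affW :=
  ((y.1 * x.1)%g, act (y.1^-1)%g x.2 + y.2).

Definition aff_act (x : affW) (b : affV) : affV :=
  (act x.1 b.1, b.2 - dot x.2 b.1).

Definition aff_pos (b : affV) : Prop :=
  (b.1 \in pos_roots /\ b.2 = 0) \/
  [/\ b.1 \in roots, b.2 \is a Num.int & 0 < b.2].

Definition aff_posJ (J : {set 'I_n}) (b : affV) : Prop :=
  [/\ rootsJ J b.1, b.1 \in pos_roots & b.2 = 0] \/
  [/\ rootsJ J b.1, b.2 \is a Num.int & 0 < b.2].

Definition aff_refl (b : affV) : affW := (refl b.1, b.2 *: coroot b.1).

Definition in_WJaf (J : {set 'I_n}) (x : affW) : Prop :=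
  in_Waf x /\ forall b : affV, aff_posJ J b -> aff_pos (aff_act x b).

Definition si_length (x : affW) : R := (weyl_length x.1)%:R + 2 * dot x.2 rho.

Definition si_cover (J : {set 'I_n}) (x y : affW) : Prop :=
  [/\ in_WJaf J x, in_WJaf J y &
      exists b : affV,
        [/\ aff_pos b, y = affM (aff_refl b) x
          & si_length y = si_length x + 1]].

Definition si_le (J : {set 'I_n}) : affW -> affW -> Prop :=
  clos_refl_trans affW (si_cover J).

(** Column tableaux with [k] boxes; [k] is not shifted here. *)
Definition CST (k : nat) : {set {set Cn n}} :=
  [set T : {set Cn n} | (#|T| == k) &&
     [forall c in T, forall d in T, (Cnorm c == Cnorm d) ==> (c == d)]].

(** T(u) for 1 <= u <= #|T|, as a natural number; [enum T] is increasing. *)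
Definition entry (T : {set Cn n}) (u : nat) : nat :=
  nth 0%N [seq val c | c <- enum T] u.-1.

Definition CST_le (k : nat) (Tc Td : {set Cn n} * int) : Prop :=
  let: (T, c) := Tc in let: (T', c') := Td in
  [/\ T \in CST k, T' \in CST k, c <= c' &
      forall u : nat, (0 < u)%N -> u%:Z <= k%:Z - c' + c ->
        (entry T u <= entry T' (u + `|c' - c|))%N].

Definition tab (k : nat) (w : {perm Cn n}) : {set Cn n} :=
  [set w c | c : Cn n & (c < k)%N].

(** For the ordinal [i] of value i-1 the tableau has i boxes, hence [i.+1]. *)
Definition Y (i : 'I_n) (x : affW) : {set Cn n} * int :=
  (tab i.+1 x.1, coroot_coef i x.2).

End RootSystem.

(** [coord] is meaningful here because the simple coroots are free. *)

Lemma coroot_simple_root (R : realType) n (i : 'I_n) :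
  coroot (simple_root R i) = eps R n i - eps R n i.+1.
Proof.
have dE (s : 'I_n) (v : 'rV[R]_n) : dot (eps R n s) v = v 0 s.
  rewrite /dot (bigD1 s) //= mxE eqxx mul1r big1 ?addr0 // => t ts.
  by rewrite mxE (inj_eq val_inj) (negPf ts) mul0r.
have dB (u v w : 'rV[R]_n) : dot (u - v) w = dot u w - dot v w.
  by rewrite /dot -sumrB; apply: eq_bigr => s _; rewrite !mxE mulrBl.
have dZ (u w : 'rV[R]_n) k : dot (k *: u) w = k * dot u w.
  by rewrite /dot mulr_sumr; apply: eq_bigr => s _; rewrite !mxE mulrA.
rewrite /coroot /simple_root; case: ifPn => [lt|ge].
  rewrite dB dE -[X in dot (eps _ _ X) _]/(nat_of_ord (Ordinal lt)) dE !mxE !eqxx /=.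
  rewrite eqn_leq ltnn andbF eqn_leq ltnn /= subr0 sub0r opprK.
  by rewrite divff ?scale1r // pnatr_eq0.
rewrite dZ dE !mxE eqxx mulr1 scalerA.
have -> : eps R n i.+1 = 0.
  apply/rowP => j; rewrite !mxE; case: eqP => // ji; case/negP: ge; rewrite -ji; exact: ltn_ord.
rewrite subr0.
have -> : (2 / (2 * 2) * 2 : R) = 1 by rewrite invfM mulrA divff ?mul1r ?mulVf ?pnatr_eq0.
by rewrite scale1r.
Qed.

Lemma free_simple_coroots (R : realType) n : free (simple_coroots R n).
Proof.
pose p (i : 'I_n) (v : 'rV[R]_n) := \sum_(s < n | (s <= i)%N) v 0 s.
have pE (i j : 'I_n) : p i (coroot (simple_root R j)) = (i == j)%:R.
  rewrite coroot_simple_root /p.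
  have pe k : \sum_(s < n | (s <= i)%N) eps R n k 0 s = (k <= i)%:R :> R.
    case: (ltnP k n) => [kn|nk]; last first.
      rewrite leqNgt (leq_trans (ltn_ord i) nk) /= big1 // => s _; rewrite mxE.
      by case: eqP => // sk; move: (ltn_ord s); rewrite sk ltnNge nk.
    case: leqP => ki.
      rewrite (bigD1 (Ordinal kn)) //= mxE eqxx big1 ?addr0 // => s /andP[_ sk].
      by rewrite mxE -[k]/(val (Ordinal kn)) (inj_eq val_inj) (negPf sk).
    rewrite big1 // => s si; rewrite mxE; case: eqP => // sk.
    by move: si; rewrite sk leqNgt ki.
  under eq_bigr do rewrite !mxE.
  rewrite sumrB; have := pe j; under eq_bigr do rewrite mxE; move=> ->.
  have := pe j.+1; under eq_bigr do rewrite mxE; move=> ->.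
  rewrite -val_eqE /=; case: ltngtP => _; rewrite ?subrr ?subr0 //.
apply/freeP => k k0 i.
have := congr1 (p i) k0.
have -> : p i (\sum_j k j *: (simple_coroots R n)`_j) = \sum_j k j * p i (coroot (simple_root R j)).
  rewrite /p; under eq_bigr do rewrite summxE; rewrite exchange_big; apply: eq_bigr => j _.
  rewrite mulr_sumr; apply: eq_bigr => s _; by rewrite -tnth_nth tnth_mktuple mxE.
rewrite (bigD1 i) //= pE eqxx mulr1 big1 ?addr0; last first.
  by move=> j ji; rewrite pE eq_sym (negPf ji) mulr0.
by move=> ->; rewrite /p big1 // => s _; rewrite mxE.
Qed.

Lemma coroot_coefE (R : realType) n (c : 'I_n -> int) (i : 'I_n) :
  coroot_coef i (\sum_(j < n) (c j)%:~R *: coroot (simple_root R j)) = c i.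
Proof.
rewrite /coroot_coef.
have -> : \sum_(j < n) (c j)%:~R *: coroot (simple_root R j)
        = \sum_(j < n) (c j)%:~R *: (simple_coroots R n)`_j.
  by apply: eq_bigr => j _; rewrite -tnth_nth tnth_mktuple.
by rewrite (coord_sum_free (fun j => (c j)%:~R)) ?free_simple_coroots // intrKfloor.
Qed.

(** The images of [Y] lie in CST x Z, so the memberships in [CST_le] only delimit
    the set on which the order is defined. *)

Lemma minn_revE (m a b : nat) : (a < m)%N -> (b < m)%N ->
  minn a (m - a.+1) = minn b (m - b.+1) -> a = b \/ a = (m - b.+1)%N.
Proof.
move=> ha hb; rewrite /minn; case: ifP => _; case: ifP => _ h; [by left| by right| |].
  right; by rewrite -h subnSK // subKn // ltnW.
left; apply: succn_inj; by rewrite -(subKn ha) h subKn.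
Qed.
Lemma tab_CST n k (w : {perm Cn n}) : (k <= n)%N -> w \in weyl n -> tab k w \in CST n k.
Proof.
rewrite !inE => kn /forallP wW; apply/andP; split.
  rewrite card_imset; last exact: perm_inj.
  have kN : (k <= n + n)%N by apply: leq_trans kn (leq_addr _ _).
  rewrite -[X in _ == X]card_ord; apply/eqP.
  rewrite -(card_imset predT (f := widen_ord kN)); last by move=> a b /(congr1 val) /= h; apply: val_inj.
  apply: eq_card => c; rewrite inE; apply/idP/imsetP => [ck|[d _ ->]]; last exact: (ltn_ord d).
  by exists (Ordinal ck) => //; apply: val_inj.
have normE (c d : Cn n) : Cnorm c = Cnorm d -> c = d \/ c = rev_ord d.
  case=> /(minn_revE (ltn_ord c) (ltn_ord d)) [] h; [left|right]; exact: val_inj.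
apply/forallP => c; apply/implyP => /imsetP[a]; rewrite inE => ak ->.
apply/forallP => d; apply/implyP => /imsetP[b]; rewrite inE => bk ->.
apply/implyP => /eqP/normE[-> //|]; rewrite -(eqP (wW b)) => /perm_inj ab.
have nb : (n <= n + n - b.+1)%N by rewrite -addnBA ?leq_addr // (leq_trans bk kn).
by move: (leq_trans ak kn); rewrite ab /= ltnNge nb.
Qed.

(* Main.v *)
Require Import Defs.
From mathcomp Require Import all_boot all_order all_fingroup all_algebra.
From mathcomp Require Import reals.
From mathcomp Require Import zify.
From Stdlib Require Import Relation_Operators.

(** An element [w t_xi] of the affine Weyl group is written as a loop [X], the
    function [X p = w p + N xi_p] on the [N = 2n] positions of the chain, where
    [xi_p] is the pairing of [xi] with [Cvec p]. Loops are exactly the functions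
    with distinct residues mod [N] and [X (rev_ord p) = N - 1 - X p]. Put
    [pcount X i m = \sum_(p < i) floor ((m - X p) / N)]. The idea is that every
    notion of the theorem becomes a statement on these integers.

    - A tableau entry [T(u)] is at most [m] iff [T] has at least [u] entries at
      most [m]. Hence the tableau inequality at [i] says that the counts of [y]
      are at most the counts of [x] on the first [i] positions, for all [m]
      ([CST_le_pcount]).
    - The prefix sizes [i] outside [J], and their mirror images [N - i], cut the
      positions into blocks. Membership in [(W^J)_af] says that the values in a
      block increase and span less than one period ([in_WJafP]).
    - An affine reflection exchanges, up to periods, the values at two positions
      [j < k] and at the mirror positions ([aff_refl_loop]).
    - Twice the semi-infinite length is [len2], a sum of rounded-down differences
      of values over pairs of positions ([si_lengthE]).

    From left to right, the exchange that realizes a cover either raises or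
    lowers the value at the smaller position [j]. Raising always increases the
    length ([len2_sym_exch_rise]), so a cover raises, and raising an early value
    can only lower the counts.

    From right to left, suppose that the counts of [X] dominate those of [Y] at
    the cuts but are not all equal. In the first block where they differ there
    are a value [X j] and a bound [z > X j] such that the counts differ
    throughout [X j, z[, for every cut before the next block that has a value
    in ]X j, z] ([excess_interval]). Take the first such block, and exchange
    [X j] with the least value [v] of that block in this interval. If that block
    contains or follows the middle and the mirror image of [X j] lies in
    ]X j, v], exchange [X j] with this mirror image instead. Minimality of the
    block and of [v] says that no value at a position in between lies strictly
    between the exchanged ones. This makes the length go up by exactly one and
    keeps all blocks sorted, while the counts drop only where they were strictly
    larger than those of [Y] ([good_step_rev], [good_step_pair]). Iterating ends
    at a loop with the counts of [Y] at the cuts. Inside a block of a sorted loop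
    the counts are determined by those at both ends of the block, in a monotone
    way ([cut_leW]), so this loop is [Y]. *)

Set Implicit Arguments.
Unset Strict Implicit.
Unset Printing Implicit Defensive.

Import Order.TTheory GRing.Theory Num.Theory.
Local Open Scope ring_scope.

(** * Rounded-down distances modulo a period *)

(** As a function of [b] it counts, up to an additive constant, the
    representatives of [a] mod [N] that are at most [b]. *)
Definition flr (N a b : int) : int := ((b - a) %/ N)%Z.

(** Some representative of [y] mod [N] lies in ]x, z] (see [hitP]). The
    formulation by an increment of [flr] is the one that prefix counts need. *)
Definition hit (N y x z : int) : bool := flr N y x < flr N y z.

Section Floor.
Variables (N : int) (N_gt0 : 0 < N).
Local Notation fl := (flr N).

Lemma flr_bounds a b : N * fl a b <= b - a < N * fl a b + N.
Proof.
have N0 : N != 0 by lia.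
have e := divz_eq (b - a) N.
have h1 : 0 <= ((b - a) %% N)%Z by exact: modz_ge0.
have h2 : ((b - a) %% N)%Z < N by exact: ltz_pmod.
by rewrite /flr; lia.
Qed.

Lemma flr_eq a b q : N * q <= b - a < N * q + N -> fl a b = q.
Proof.
move=> h; have := flr_bounds a b; set f := fl a b => h'.
have h1 : N * (f - q) < N by lia.
have h2 : N * (q - f) < N by lia.
have := N_gt0; nia.
Qed.

Lemma flr_shiftl a b t : fl (a + N * t) b = fl a b - t.
Proof. by apply: flr_eq; have := flr_bounds a b; lia. Qed.

Lemma flr_shiftr a b t : fl a (b + N * t) = fl a b + t.
Proof. by apply: flr_eq; have := flr_bounds a b; lia. Qed.

(** Between two incongruent points, one of the two rounded-down distances
    loses exactly one whole period. *)
Lemma flr_anti a b : (forall t, a <> b + N * t) -> fl b a = -1 - fl a b.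
Proof.
move=> ne; apply: flr_eq; have := flr_bounds a b.
have := ne (- fl a b); lia.
Qed.

Lemma flr_refl a m : fl (N - 1 - a) m = -1 - fl a (N - 2 - m).
Proof. by apply: flr_eq; have := flr_bounds a (N - 2 - m); lia. Qed.

Lemma flr_refl2 a b : fl (N - 1 - a) (N - 1 - b) = fl b a.
Proof. by rewrite /flr; congr (_ %/ _)%Z; lia. Qed.

Lemma flr_ge t a b : (t <= fl a b) = (N * t <= b - a).
Proof. by rewrite lez_divRL // mulrC. Qed.

Lemma le_flr2 a b b' : b <= b' -> fl a b <= fl a b'.
Proof. by rewrite flr_ge; have := flr_bounds a b; lia. Qed.

Lemma le_flr1 a a' b : a <= a' -> fl a' b <= fl a b.
Proof. by rewrite flr_ge; have := flr_bounds a' b; lia. Qed.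

Lemma hitP y x z : reflect (exists t, x < y + N * t <= z) (hit N y x z).
Proof.
apply: (iffP idP) => [|[t ht]].
  rewrite /hit; move=> h; exists (fl y z).
  have := flr_ge (fl y z) y z; rewrite lexx; move/esym => hz.
  have := flr_ge (fl y z) y x; rewrite leNgt h /= => /esym/negbT hx.
  lia.
rewrite /hit; apply: (@lt_le_trans _ _ t); last by rewrite flr_ge; lia.
by rewrite ltNge flr_ge; lia.
Qed.

Lemma hitPn y x z : ~~ hit N y x z -> x <= z -> fl y x = fl y z.
Proof. by rewrite /hit -leNgt => h1 /(le_flr2 y) h2; apply/eqP; rewrite eq_le h1 h2. Qed.

Lemma hit_open y x v :
  (forall t, y + N * t <> v) -> hit N y x v = hit N y x (v - 1).
Proof.
by move=> ne; apply/hitP/hitP => -[t ht]; exists t; have := ne t; lia.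
Qed.

Lemma hit_shift y x z s t : hit N (y + N * s) (x + N * t) (z + N * t) = hit N y x z.
Proof.
apply/hitP/hitP => -[u hu].
  by exists (u + s - t); lia.
by exists (u - s + t); lia.
Qed.

Lemma hit_le y x z z' : z <= z' -> hit N y x z -> hit N y x z'.
Proof. by move=> h /hitP[t ht]; apply/hitP; exists t; lia. Qed.

(** [x + offset x y] is the least representative of [y] that is at least
    [x]. *)
Definition offset (x y : int) : int := ((y - x) %% N)%Z.

Lemma offsetP x y : exists2 t, x + offset x y = y + N * t & 0 <= offset x y < N.
Proof.
exists (- ((y - x) %/ N)%Z); first by have := divz_eq (y - x) N; rewrite /offset; lia.
have h1 : 0 <= ((y - x) %% N)%Z by apply: modz_ge0; lia.
by rewrite h1 ltz_pmod.
Qed.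

Lemma offset_min x y t : x < y + N * t -> (x + offset x y <= y + N * t).
Proof.
case: (offsetP x y) => s e /andP[h0 h1] ht.
rewrite leNgt; apply/negP => h.
have : N * (s - t) < N * 1 by lia.
have : 0 < N * (s - t) by lia.
by rewrite pmulr_rgt0 // ltr_pM2l //; lia.
Qed.

End Floor.

(** * Loops, exchanges and prefix counts *)

Lemma sum_bigD2 (I : finType) (f : I -> int) (j k : I) : j != k ->
  \sum_p f p = f j + f k + \sum_(p | (p != j) && (p != k)) f p.
Proof.
by move=> jk; rewrite (bigD1 j) //= (bigD1 k) 1?eq_sym //= addrA.
Qed.

Section Loops.
Variables (n : nat) (n_gt0 : (0 < n)%N).
Local Notation N := (Posz (n + n)).
Local Notation fl := (flr N).
Local Notation hit := (hit N).
Local Notation loop := {ffun 'I_(n + n) -> int}.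
Implicit Types (X Y : loop) (p q j k l : 'I_(n + n)) (r m t : int) (i : nat).

Let N_gt0 : 0 < N. Proof. lia. Qed.

(** Together with [residue_inj] this characterizes the functions that come
    from elements of the affine Weyl group. *)
Definition symm X : Prop := forall p, X (rev_ord p) = N - 1 - X p.

Definition residue_inj X : Prop := forall p q t, X p = X q + N * t -> p = q.

(** For [m] in [0, N[ this is the number of values of [w] at most [m] on
    the first [i] positions, minus [i] and minus the sum of the [xi_p] there.
    Letting [m] range over all integers costs nothing by [pcount_period], and it
    makes the shifts by [c' - c] in the order on tableaux disappear. *)
Definition pcount X i m : int := \sum_(p < n + n | (p < i)%N) fl (X p) m.

Definition exch X j k r : loop :=
  [ffun p => if p == j then X k + N * r else
             if p == k then X j - N * r else X p].

(** The first two clauses take precedence because for [k = rev_ord j] the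
    mirror clauses describe the same two positions. *)
Definition sym_exch X j k r : loop :=
  [ffun p => if p == j then X k + N * r else
             if p == k then X j - N * r else
             if p == rev_ord j then X (rev_ord k) - N * r else
             if p == rev_ord k then X (rev_ord j) + N * r else X p].

Lemma loop_ext X Y : (forall p, X p = Y p) -> X = Y.
Proof. by move=> e; apply/ffunP. Qed.

Lemma rev_eq p q : (rev_ord p == q) = (p == rev_ord q).
Proof. by rewrite -(inj_eq rev_ord_inj) rev_ordK. Qed.

Lemma rev_neq p : rev_ord p != p.
Proof. by apply/eqP => /(congr1 val) /=; have := ltn_ord p; lia. Qed.

Lemma exch_l X j k r : exch X j k r j = X k + N * r.
Proof. by rewrite ffunE eqxx. Qed.

Lemma exch_r X j k r : j != k -> exch X j k r k = X j - N * r.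
Proof. by rewrite eq_sym ffunE => /negPf ->; rewrite eqxx. Qed.

Lemma exch_other X j k r p : p != j -> p != k -> exch X j k r p = X p.
Proof. by rewrite ffunE => /negPf -> /negPf ->. Qed.

Lemma sym_exch_rev X j r : sym_exch X j (rev_ord j) r = exch X j (rev_ord j) r.
Proof.
apply: loop_ext => p; rewrite !ffunE rev_ordK.
by case: eqP => // _; case: eqP.
Qed.

Lemma sym_exch_exch X j k r : j != k -> k != rev_ord j ->
  sym_exch X j k r = exch (exch X j k r) (rev_ord k) (rev_ord j) r.
Proof.
move=> jk kj; apply: loop_ext => p; rewrite !ffunE.
have kj' : (rev_ord k == j) = false by rewrite rev_eq (negPf kj).
have jk' : (rev_ord j == k) = false by rewrite eq_sym (negPf kj).
rewrite kj' jk' !(negPf (rev_neq _)).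
case: (eqVneq p j) => [->|pj].
  by rewrite [j == rev_ord k]eq_sym kj' eq_sym (negPf (rev_neq j)).
case: (eqVneq p k) => [->|pk].
  by rewrite eq_sym (negPf (rev_neq k)) (negPf kj).
case: (eqVneq p (rev_ord j)) => [->|//].
by rewrite (inj_eq rev_ord_inj) (negPf jk).
Qed.

(** A prefix that contains both positions does not notice the exchange: the
    two shifts by [r] periods cancel. *)
Lemma pcount_exch X j k r i m : (j < k)%N ->
  pcount (exch X j k r) i m = pcount X i m +
    (if (j < i <= k)%N then fl (X k + N * r) m - fl (X j) m else 0).
Proof.
move=> jk; have jk' : j != k by rewrite -val_eqE /= ltn_eqF.
rewrite /pcount [LHS]big_mkcond [X in _ = X + _]big_mkcond /=.
rewrite !(sum_bigD2 _ jk') exch_l exch_r //.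
under [X in _ + X = _]eq_bigr => p /andP[pj pk] do rewrite exch_other //.
rewrite -[- (N * r)]mulrN !flr_shiftl //.
by case: (ltnP j i) => h1; case: (leqP i k) => h2; case: (ltnP k i) => h3 /=; lia.
Qed.

Lemma sym_exch_symm X j k r : symm X -> j != k -> symm (sym_exch X j k r).
Proof.
move=> sX jk; case: (eqVneq k (rev_ord j)) => [->|kj] p.
  rewrite sym_exch_rev !ffunE (inj_eq rev_ord_inj) rev_eq sX.
  case: (eqVneq p j) => [->|pj]; case: (eqVneq _ (rev_ord j)) => [e|pj'] //; try lia.
  by have := rev_neq j; rewrite -e eqxx.
have kj' : (rev_ord k == j) = false by rewrite rev_eq (negPf kj).
rewrite !ffunE !(inj_eq rev_ord_inj) !rev_eq !sX.
case: (eqVneq p (rev_ord j)) => [->|pj'].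
  by rewrite (negPf (rev_neq j)) eq_sym (negPf kj); lia.
case: (eqVneq p (rev_ord k)) => [->|pk'].
  by rewrite (negPf (rev_neq k)) kj'; lia.
by case: (eqVneq p j) => _; [|case: (eqVneq p k) => _]; lia.
Qed.

Lemma exch_inj X j k r : residue_inj X -> residue_inj (exch X j k r).
Proof.
move=> iX p q t; have swE l : exists c, exch X j k r l = X (tperm j k l) + N * c.
  rewrite ffunE; case: tpermP => [->|->|/eqP/negPf -> /eqP/negPf ->].
  - by rewrite eqxx; exists r.
  - by case: eqP => [->|_]; [exists r|rewrite eqxx; exists (- r); lia].
  - by exists 0; lia.
have [c ->] := swE p; have [d ->] := swE q => e.
by apply: (perm_inj (s := tperm j k)); apply: (iX _ _ (t + d - c)); lia.
Qed.

Lemma sym_exch_inj X j k r : residue_inj X -> j != k -> residue_inj (sym_exch X j k r).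
Proof.
move=> iX jk; case: (eqVneq k (rev_ord j)) => [->|kj].
  by rewrite sym_exch_rev; apply: exch_inj.
by rewrite sym_exch_exch //; do 2!apply: exch_inj.
Qed.

Lemma exchK X j k r : j != k -> exch (exch X j k r) j k r = X.
Proof.
move=> jk; apply: loop_ext => p; case: (eqVneq p j) => [->|pj].
  by rewrite exch_l exch_r //; lia.
case: (eqVneq p k) => [->|pk]; first by rewrite exch_r // exch_l; lia.
by rewrite !exch_other.
Qed.

Lemma sym_exchK X j k r : j != k -> sym_exch (sym_exch X j k r) j k r = X.
Proof.
move=> jk; case: (eqVneq k (rev_ord j)) => [kj|kj].
  by rewrite kj !sym_exch_rev exchK // -kj.
apply: loop_ext => p; rewrite !ffunE.
have kj' : (rev_ord k == j) = false by rewrite rev_eq (negPf kj).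
have jk' : (rev_ord j == k) = false by rewrite eq_sym (negPf kj).
rewrite !eqxx !(inj_eq rev_ord_inj) kj' jk' !(negPf (rev_neq _)) [k == j]eq_sym (negPf jk).
case: (eqVneq p j) => [->|pj]; first by lia.
case: (eqVneq p k) => [->|pk]; first by lia.
case: (eqVneq p (rev_ord j)) => [->|pj']; first by lia.
by case: eqP => [->|//]; lia.
Qed.

Lemma sym_exch_mirror X j k r : j != k -> sym_exch X j k r
  = sym_exch X (rev_ord k) (rev_ord j) r.
Proof.
move=> jk; apply: loop_ext => p; rewrite !ffunE !rev_ordK.
case: (eqVneq p j) => [->|pj].
  rewrite [j == rev_ord j]eq_sym (negPf (rev_neq j)) (negPf jk).
  by case: eqP => [->|//]; rewrite rev_ordK.
case: (eqVneq p k) => [->|pk].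
  rewrite [k == rev_ord k]eq_sym (negPf (rev_neq k)).
  by case: eqP => [->|//]; rewrite rev_ordK.
case: (eqVneq p (rev_ord j)) => [->|pj'].
  by rewrite (inj_eq rev_ord_inj) (negPf jk).
by [].
Qed.

Lemma pcount0 X m : pcount X 0 m = 0.
Proof. by rewrite /pcount big1. Qed.

Lemma pcountS X p m : pcount X p.+1 m = pcount X p m + fl (X p) m.
Proof.
rewrite /pcount (bigD1 p) //= addrC; congr (_ + _); apply: eq_bigl => q.
by rewrite ltnS ltn_neqAle andbC -val_eqE.
Qed.

Lemma sum_below_const i (c : int) : (i <= n + n)%N ->
  \sum_(p < n + n | (p < i)%N) c = c * i%:Z.
Proof.
move=> iN; rewrite (big_ord_narrow iN) sumr_const card_ord -mulr_natr.
by congr (_ * _); rewrite natz.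
Qed.

Lemma pcount_period X i m t : (i <= n + n)%N -> pcount X i (m + N * t)
  = pcount X i m + t * i%:Z.
Proof.
move=> iN; rewrite /pcount; under eq_bigr do rewrite flr_shiftr //.
by rewrite big_split /= sum_below_const.
Qed.

Lemma pcount_rev X i m : symm X -> (i <= n + n)%N ->
  pcount X (n + n - i) m = pcount X (n + n) m + i%:Z + pcount X i (N - 2 - m).
Proof.
move=> sX iN.
have -> : pcount X (n + n) m = pcount X (n + n - i) m
    + \sum_(p < n + n | (p < i)%N) fl (X (rev_ord p)) m.
  rewrite /pcount (bigID (fun p : 'I_(n + n) => (p < n + n - i)%N)) /=; congr (_ + _).
    by apply: eq_bigl => p; rewrite ltn_ord.
  rewrite [LHS](reindex_inj rev_ord_inj) /=; apply: eq_bigl => p.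
  by have := ltn_ord p; lia.
under [X in _ = _ + X + _ + _]eq_bigr => p _ do rewrite sX flr_refl //.
rewrite big_split /= !sumrN sum_below_const // -!/(pcount X _ _); lia.
Qed.

(** Every residue occurs once, and the numbers of periods in [X p] and
    [X (rev_ord p)] cancel; so the full count is the same for all loops. *)
Lemma pcount_full X m : symm X -> residue_inj X -> pcount X (n + n) m =
  \sum_(c < n + n) fl c%:Z m.
Proof.
move=> sX iX.
have ltN x : (`|(x %% N)%Z|%N < n + n)%N.
  have h : 0 <= (x %% N)%Z by apply: modz_ge0; lia.
  by have := ltz_pmod x N_gt0; lia.
pose c p : 'I_(n + n) := Ordinal (ltN (X p)).
have cE p : X p = (c p)%:Z + N * (X p %/ N)%Z.
  have := divz_eq (X p) N; rewrite /=.
  have : 0 <= (X p %% N)%Z by apply: modz_ge0; lia.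
  lia.
have c_inj : injective c.
  by move=> p q e; apply: (iX _ _ ((X p %/ N)%Z - (X q %/ N)%Z)); have := cE p;
    have := cE q; rewrite e; lia.
have -> : pcount X (n + n) m = \sum_p (fl (c p)%:Z m - (X p %/ N)%Z).
  rewrite /pcount; apply: eq_big => [p|p _]; first by rewrite ltn_ord.
  by rewrite {1}cE flr_shiftl.
rewrite sumrB [X in _ = X](reindex_inj c_inj) /=.
set S := \sum_p (X p %/ N)%Z.
have : S = - S.
  rewrite -sumrN /S (reindex_inj rev_ord_inj); apply: eq_bigr => p _.
  have flr0 x : (x %/ N)%Z = fl 0 x by rewrite /flr subr0.
  by rewrite sX !flr0; apply: flr_eq => //; have := flr_bounds N_gt0 0 (X p); lia.
move=> e; have -> : S = 0 by lia.
by rewrite subr0.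
Qed.

End Loops.

(** * Lengths of loops *)

Section Lengths.
Variables (n : nat) (n_gt0 : (0 < n)%N).
Local Notation N := (Posz (n + n)).
Local Notation fl := (flr N).
Local Notation hit := (hit N).
Local Notation loop := {ffun 'I_(n + n) -> int}.
Implicit Types (X Y : loop) (p q j k l : 'I_(n + n)) (r m t : int) (i : nat).

Let N_gt0 : 0 < N. Proof. lia. Qed.

(** This is minus the sum of the rounded-down differences, because
    [fl (X p) (X q)] is [-1] at an inversion [X p > X q] of values in one
    period. *)
Definition lenA X : int :=
  - \sum_(p < n + n) \sum_(q < n + n) (if (p < q)%N then fl (X p) (X q) else 0).

Definition lenC X : int :=
  - \sum_(p < n + n | (p < n)%N) fl (X p) (X (rev_ord p)).

(** Positive roots of type C are the mirror classes of pairs of positions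
    [p < q]. Such a class has two elements, except for [q = rev_ord p]; adding
    [lenC] makes [len2] count every root twice. *)
Definition len2 X : int := lenA X + lenC X.

(** For [l] between [j] and [k], the pairs [(j, l)] and [(l, k)] contribute
    the same change, the number of representatives of [X l] between [X j] and its
    new value; for [l] outside, the changes in the two pairs cancel. *)
Lemma lenA_exch X j k r : residue_inj X -> (j < k)%N ->
  lenA (exch X j k r) = lenA X + 1 + 2 * fl (X j) (X k + N * r)
    + 2 * \sum_(l < n + n | (j < l < k)%N) (fl (X l) (X k + N * r) - fl (X l) (X j)).
Proof.
move=> iX jk; have jk' : j != k by rewrite -val_eqE /= ltn_eqF.
have kj : (k < j)%N = false by lia.
pose h (Z : loop) p q : int := if (p < q)%N then fl (Z p) (Z q) else 0.
pose around Z l := h Z j l + h Z k l + (h Z l j + h Z l k).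
have split Z : \sum_(p < n + n) \sum_(q < n + n) h Z p q
    = h Z j k + \sum_(l < n + n | (l != j) && (l != k)) around Z l
    + \sum_(p < n + n | (p != j) && (p != k))
        \sum_(q < n + n | (q != j) && (q != k)) h Z p q.
  rewrite !(sum_bigD2 _ jk').
  under [X in _ + X = _]eq_bigr do rewrite (sum_bigD2 _ jk').
  have -> : h Z j j = 0 by rewrite /h ltnn.
  have -> : h Z k k = 0 by rewrite /h ltnn.
  have -> : h Z k j = 0 by rewrite /h kj.
  rewrite /around !big_split /=.
  set S1 := \sum_(_ < _ | _) h Z j _; set S2 := \sum_(_ < _ | _) h Z k _.
  set S3 := \sum_(_ < _ | _) h Z _ j; set S4 := \sum_(_ < _ | _) h Z _ k.
  by set S5 := \sum_(_ < _ | _) \sum_(_ < _ | _) _; lia.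
set v := X k + N * r.
have Xk : X k = v + N * (- r) by rewrite /v; lia.
have ev : exch X j k r j = v by rewrite exch_l.
have ej : exch X j k r k = X j + N * (- r) by rewrite exch_r //; lia.
clearbody v.
rewrite /lenA -![\sum_(p < n + n) _]/(\sum_(p < n + n) \sum_(q < n + n) h _ p q) !split.
have -> : \sum_(p < n + n | (p != j) && (p != k))
    \sum_(q < n + n | (q != j) && (q != k)) h (exch X j k r) p q
  = \sum_(p < n + n | (p != j) && (p != k))
    \sum_(q < n + n | (q != j) && (q != k)) h X p q.
  apply: eq_bigr => p /andP[pj pk]; apply: eq_bigr => q /andP[qj qk].
  by rewrite /h !exch_other.
have -> : \sum_(l < n + n | (j < l < k)%N) (fl (X l) v - fl (X l) (X j))
  = \sum_(l < n + n | (l != j) && (l != k))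
      (if (j < l < k)%N then fl (X l) v - fl (X l) (X j) else 0).
  rewrite -big_mkcondr /=; apply: eq_bigl => l.
  by rewrite -!val_eqE /=; lia.
have key : \sum_(l < n + n | (l != j) && (l != k)) around (exch X j k r) l
  = \sum_(l < n + n | (l != j) && (l != k)) around X l
    - 2 * \sum_(l < n + n | (l != j) && (l != k))
        (if (j < l < k)%N then fl (X l) v - fl (X l) (X j) else 0).
  rewrite mulr_sumr -sumrN -big_split /=; apply: eq_bigr => l /andP[lj lk].
  rewrite /around /h ev ej exch_other // Xk !flr_shiftl // !flr_shiftr //.
  have e1 : fl (X j) (X l) = -1 - fl (X l) (X j).
    by apply: flr_anti => // t e; move/eqP: lj; apply; apply: iX e.
  have e2 : fl v (X l) = -1 - fl (X l) v.
    apply: flr_anti => // t e; move/eqP: lk; apply; apply: (iX _ _ (t + r)).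
    by rewrite Xk; lia.
  move: lj lk; rewrite -!val_eqE /= => lj lk.
  by case: (ltngtP l j) lj => // hj _; case: (ltngtP l k) lk => // hk _; rewrite /=; lia.
have ejk : fl v (X j) = -1 - fl (X j) v.
  apply: flr_anti => // t e; move/eqP: jk'; apply; apply: (iX _ _ (t + r)).
  by rewrite Xk; lia.
have e1 : h (exch X j k r) j k = fl v (X j) - r by rewrite /h jk ev ej flr_shiftr.
have e2 : h X j k = fl (X j) v - r by rewrite /h jk Xk flr_shiftr.
rewrite key e1 e2 ejk.
by set A := \sum_(_ < _ | _) around X _; set B := \sum_(_ < _ | _) _;
  set C := \sum_(_ < _ | _) \sum_(_ < _ | _) _; lia.
Qed.

Lemma lenA_rise X j k r : residue_inj X -> (j < k)%N -> X j < X k + N * r ->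
  lenA (exch X j k r) >= lenA X + 1.
Proof.
move=> iX jk up; rewrite lenA_exch //.
have h1 : 0 <= fl (X j) (X k + N * r) by rewrite flr_ge //; lia.
have h2 : 0 <= \sum_(l < n + n | (j < l < k)%N) (fl (X l) (X k + N * r) - fl (X l) (X j)).
  by apply: sumr_ge0 => l _; rewrite subr_ge0 le_flr2 // ltW.
by move: h2; set S := \sum_(l | _) _; lia.
Qed.

Lemma lenA_cover X j k r : residue_inj X -> (j < k)%N -> X j < X k + N * r < X j + N ->
  (forall l, (j < l < k)%N -> ~~ hit (X l) (X j) (X k + N * r)) ->
  lenA (exch X j k r) = lenA X + 1.
Proof.
move=> iX jk /andP[up lo] free; rewrite lenA_exch //.
have -> : fl (X j) (X k + N * r) = 0 by apply: flr_eq; lia.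
rewrite big1 ?mulr0 ?addr0 // => l /free h.
by rewrite (hitPn N_gt0 h) ?subrr // ltW.
Qed.

(** It decreases by one whenever [x] passes a centre of symmetry, that is
    a point [(N - 1 + N c) / 2]. *)
Definition mirror_gap (x : int) : int := fl x (N - 1 - x).

Lemma mirror_shift x t : mirror_gap (x + N * t) = mirror_gap x - 2 * t.
Proof.
rewrite /mirror_gap flr_shiftl //.
have -> : N - 1 - (x + N * t) = N - 1 - x + N * (- t) by lia.
by rewrite flr_shiftr //; lia.
Qed.

Lemma mirror_refl x : mirror_gap (N - 1 - x) = -1 - mirror_gap x.
Proof.
rewrite /mirror_gap; have -> : N - 1 - (N - 1 - x) = x by lia.
by apply: flr_anti => // t; lia.
Qed.

Lemma mirror_le x y : x <= y -> mirror_gap y <= mirror_gap x.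
Proof.
move=> h; apply: (@le_trans _ _ (fl x (N - 1 - y))); first exact: le_flr1.
by apply: le_flr2 => //; lia.
Qed.

Lemma mirror_lt x y : mirror_gap y < mirror_gap x -> exists s, 2 * x < N - 1 + N * s < 2 * y.
Proof.
move=> h; exists (- mirror_gap x).
have := flr_ge N_gt0 (mirror_gap x) x (N - 1 - x).
have := flr_ge N_gt0 (mirror_gap x) y (N - 1 - y).
rewrite -![fl _ _]/(mirror_gap _) lexx leNgt h /= => /esym/negbT h1 /esym h2.
lia.
Qed.

Lemma lenCE X : symm X -> lenC X = - \sum_(p < n + n | (p < n)%N) mirror_gap (X p).
Proof.
by move=> sX; rewrite /lenC; congr (- _); apply: eq_bigr => p _; rewrite sX.
Qed.

Lemma sym_exch_l X j k r : sym_exch X j k r j = X k + N * r.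
Proof. by rewrite ffunE eqxx. Qed.

Lemma sym_exch_r X j k r : j != k -> sym_exch X j k r k = X j - N * r.
Proof. by rewrite eq_sym ffunE => /negPf ->; rewrite eqxx. Qed.

Lemma sym_exch_other X j k r p : p != j -> p != k -> p != rev_ord j -> p != rev_ord k ->
  sym_exch X j k r p = X p.
Proof. by rewrite ffunE => /negPf -> /negPf -> /negPf -> /negPf ->. Qed.

Lemma lenC_sym_exch_rev X j r : symm X -> (j < n)%N ->
  lenC (sym_exch X j (rev_ord j) r)
  = lenC X + 1 + 2 * fl (X j) (X (rev_ord j) + N * r).
Proof.
move=> sX jn; have jj : j != rev_ord j by rewrite eq_sym rev_neq.
rewrite !lenCE //; last exact: sym_exch_symm.
rewrite (bigD1 j) //= [X in _ = - X + _ + _](bigD1 j) //= sym_exch_l.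
rewrite (eq_bigr (fun p => mirror_gap (X p))); last first.
  move=> p /andP[pn pj]; have pj' : p != rev_ord j.
    by apply/eqP => e; move: pn; rewrite e /=; lia.
  by rewrite sym_exch_other // rev_ordK.
rewrite mirror_shift sX mirror_refl flr_shiftr // -/(mirror_gap _).
by set S := \sum_(p < n + n | _) _; lia.
Qed.

Lemma sum_two_changes (f g : 'I_(n + n) -> int) j k : j != k -> (j < n)%N -> (k < n)%N ->
  (forall p, (p < n)%N -> p != j -> p != k -> f p = g p) ->
  \sum_(p < n + n | (p < n)%N) f p - \sum_(p < n + n | (p < n)%N) g p
  = f j + f k - g j - g k.
Proof.
move=> jk jn kn fg.
rewrite (bigD1 j) //= (bigD1 k) /=; last by rewrite kn eq_sym.
rewrite [X in _ - X](bigD1 j) //= [X in _ - (_ + X)](bigD1 k) /=; last by rewrite kn eq_sym.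
rewrite [X in _ + (_ + X) - _](eq_bigr g); last first.
  by move=> p /andP[/andP[pn pj] pk]; apply: fg.
by set S := \sum_(p < n + n | _) _; lia.
Qed.

(** If [j] and [k] lie on the same side of the middle, one mirror gap gains
    what the other loses; if they lie on both sides, both lose the number of
    centres that are passed. *)
Lemma lenC_sym_exch X j k r : symm X -> (j < k)%N -> (j < n)%N -> k != rev_ord j ->
  lenC (sym_exch X j k r) = lenC X +
    (if (k < n)%N then 0 else 2 * (mirror_gap (X j) - mirror_gap (X k + N * r))).
Proof.
move=> sX jk jn kj; have jk' : j != k by rewrite -val_eqE /= ltn_eqF.
rewrite !lenCE //; last exact: sym_exch_symm.
have h p : (p < n)%N -> p != rev_ord j.
  by move=> pn; apply/eqP => e; move: pn; rewrite e /=; lia.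
case: ltnP => kn.
  have h' p : (p < n)%N -> p != rev_ord k.
    by move=> pn; apply/eqP => e; move: pn; rewrite e /=; lia.
  have := @sum_two_changes (fun p => mirror_gap (sym_exch X j k r p)) (fun p
    => mirror_gap (X p)) j k jk' jn kn.
  rewrite sym_exch_l sym_exch_r // -mulrN !mirror_shift => e.
  have {}e := e (fun p pn pj pk => congr1 mirror_gap (sym_exch_other X r pj pk (h p pn) (h'
    p pn))).
  by move: e; set S := \sum_(p < n + n | _) _; set S' := \sum_(p < n + n | _) _; lia.
have h' p : (p < n)%N -> p != k.
  by move=> pn; apply/eqP => e; move: pn; rewrite e /=; lia.
have rkn : (rev_ord k < n)%N by rewrite /=; have := ltn_ord k; lia.
have jrk : j != rev_ord k by rewrite -rev_eq eq_sym.
have := @sum_two_changes (fun p => mirror_gap (sym_exch X j k r p)) (fun p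
  => mirror_gap (X p)) j (rev_ord k) jrk jn rkn.
rewrite sym_exch_l (sym_exch_symm n_gt0 r sX jk') sym_exch_r // sX !mirror_refl -mulrN
  !mirror_shift => e.
have {}e := e (fun p pn pj pk => congr1 mirror_gap (sym_exch_other X r pj (h' p pn) (h p
  pn) pk)).
by move: e; set S := \sum_(p < n + n | _) _; set S' := \sum_(p < n + n | _) _; lia.
Qed.

(** Raising the value at the smaller position increases [lenA] for the
    exchange and for its mirror image, and does not decrease [lenC]. Hence the
    sign of the length difference tells whether a reflection raises it. *)
Lemma len2_sym_exch_rise X j k r : symm X -> residue_inj X -> (j < k)%N ->
  X j < X k + N * r -> len2 X + 2 <= len2 (sym_exch X j k r).
Proof.
move=> sX iX.
wlog jn : j k / (j < n)%N => [wl jk up|jk up].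
  case: (ltnP j n) => jn; first exact: wl.
  have jk' : j != k by rewrite -val_eqE /= ltn_eqF.
  rewrite sym_exch_mirror //; apply: wl; rewrite ?sX /=; have := ltn_ord k; lia.
have jk' : j != k by rewrite -val_eqE /= ltn_eqF.
case: (eqVneq k (rev_ord j)) => [kj|kj].
  rewrite /len2 kj lenC_sym_exch_rev // sym_exch_rev -kj.
  have h1 : 0 <= fl (X j) (X k + N * r) by rewrite flr_ge //; lia.
  by have := lenA_rise iX jk up; lia.
rewrite /len2 lenC_sym_exch // sym_exch_exch //.
have iX1 := exch_inj n_gt0 (j := j) (k := k) (r := r) iX.
have h1 := lenA_rise iX jk up.
have jrk : rev_ord j != k by rewrite eq_sym.
have rkj : rev_ord k != j by rewrite rev_eq.
have h2 : lenA (exch X j k r) + 1 <= lenA (exch (exch X j k r) (rev_ord k) (rev_ord j) r).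
  apply: lenA_rise => //=; first by have := ltn_ord k; lia.
  by rewrite !exch_other ?rev_neq // !sX; lia.
by case: ifP => _; [lia|have := mirror_le (ltW up); lia].
Qed.

Lemma hit_reflect x v y : (forall t, y + N * t <> x) ->
  hit (N - 1 - y) (N - 1 - v) (N - 1 - x) -> hit y x v.
Proof.
by move=> ne /(hitP N_gt0)[t ht]; apply/(hitP N_gt0); exists (- t); have := ne (- t); lia.
Qed.

(** The type A length and the central term both go up by one. *)
Lemma len2_cover_rev X j r : symm X -> residue_inj X -> (j < n)%N ->
  X j < X (rev_ord j) + N * r < X j + N ->
  (forall l, (j < l < rev_ord j)%N -> ~~ hit (X l) (X j) (X (rev_ord j) + N * r)) ->
  len2 (sym_exch X j (rev_ord j) r) = len2 X + 2.
Proof.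
move=> sX iX jn h free; rewrite /len2 lenC_sym_exch_rev // sym_exch_rev lenA_cover //;
  last by rewrite /=; lia.
have -> : fl (X j) (X (rev_ord j) + N * r) = 0 by apply: flr_eq; lia.
by lia.
Qed.

(** The mirror exchange is made after the exchange of [j] and [k]. When the
    two position intervals overlap, the values already moved may lie between;
    the conditions on [rev_ord k] and [rev_ord j] exclude this. The last
    condition says that no centre of symmetry is passed. *)
Lemma len2_cover X j k r : symm X -> residue_inj X -> (j < k)%N -> (j < n)%N ->
  k != rev_ord j ->
  X j < X k + N * r < X j + N ->
  (forall l, (j < l < k)%N -> ~~ hit (X l) (X j) (X k + N * r)) ->
  ((rev_ord k < j)%N -> ~~ hit (X (rev_ord k)) (X j) (X k + N * r)) ->
  ((n <= k)%N -> ~~ hit (X (rev_ord j)) (X j) (X k + N * r)) ->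
  ((n <= k)%N -> mirror_gap (X k + N * r) = mirror_gap (X j)) ->
  len2 (sym_exch X j k r) = len2 X + 2.
Proof.
move=> sX iX jk jn kj up free freek freej ephi.
have jk' : j != k by rewrite -val_eqE /= ltn_eqF.
have iX1 := exch_inj n_gt0 (j := j) (k := k) (r := r) iX.
have jrk : rev_ord j != k by rewrite eq_sym.
have rkj : rev_ord k != j by rewrite rev_eq.
rewrite /len2 lenC_sym_exch // sym_exch_exch //.
have -> : lenA (exch (exch X j k r) (rev_ord k) (rev_ord j) r) = lenA (exch X j k r) + 1.
  apply: lenA_cover => //=; first by have := ltn_ord k; lia.
    by rewrite !exch_other ?rev_neq // !sX; lia.
  move=> l hl.
  have -> : exch X j k r (rev_ord k) = X (rev_ord k) by rewrite exch_other ?rev_neq.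
  have -> : exch X j k r (rev_ord j) = X (rev_ord j) by rewrite exch_other ?rev_neq.
  rewrite !sX.
  have -> : N - 1 - X k = (N - 1 - (X k + N * r)) + N * r by lia.
  case: (eqVneq l j) => [e|lj].
    rewrite e exch_l; apply/negP => hh.
    have /negP := freek ltac:(move: hl; rewrite e /=; lia); apply.
    apply: hit_reflect; first by move=> t e'; move/eqP: rkj; apply; apply: (iX _ _ (- t)); lia.
    by rewrite sX; move: hh; rewrite -(hit_shift N_gt0 _ _ _ (- r) (- r));
      congr (hit _ _ _); lia.
  case: (eqVneq l k) => [e|lk].
    rewrite e exch_r //; apply/negP => hh.
    have /negP := freej ltac:(move: hl; rewrite e /=; lia); apply.
    apply: hit_reflect; first by move=> t e'; move/eqP: (rev_neq n_gt0 j); apply;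
      apply: (iX _ _ (- t)); lia.
    by rewrite sX; move: hh; rewrite -(hit_shift N_gt0 _ _ _ r (- r)); congr (hit _ _ _); lia.
  rewrite exch_other //; apply/negP => hh.
  have /negP := free (rev_ord l) ltac:(rewrite /=; have := ltn_ord l; lia); apply.
  apply: hit_reflect.
    move=> t e'; have : rev_ord l = j by apply: (iX _ _ (- t)); lia.
    by move/(congr1 val) => /=; have := ltn_ord l; lia.
  by rewrite sX; move: hh; rewrite -(hit_shift N_gt0 _ _ _ 0 (- r)); congr (hit _ _ _); lia.
rewrite lenA_cover //; case: ltnP => kn; first lia.
by rewrite ephi //; lia.
Qed.

End Lengths.

(** * Blocks of positions and comparison at the cuts *)

Section Blocks.
Variables (n : nat) (cut : pred nat).
Local Notation N := (Posz (n + n)).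
Local Notation fl := (flr N).
Local Notation hit := (hit N).
Local Notation loop := {ffun 'I_(n + n) -> int}.
Implicit Types (X Y : loop) (p q j k l : 'I_(n + n)) (r m t : int) (i : nat).

(** Prefix sizes are compared with positions: [i <= p] says that position
    [p] is not among the first [i]. *)
Definition same_block p q : bool :=
  [forall i : 'I_(n + n), cut i ==> ((i <= p)%N == (i <= q)%N)].

Definition sorted_loop X : Prop :=
  forall p q, (p < q)%N -> same_block p q -> fl (X p) (X q) = 0.

Definition cut_le X Y : Prop :=
  forall i, (i <= n + n)%N -> cut i -> forall m, pcount Y i m <= pcount X i m.

Lemma same_blockP p q : reflect (forall i, cut i -> (i <= p)%N = (i <= q)%N) (same_block p q).
Proof.
apply: (iffP forallP) => [h i ci|h i]; last by apply/implyP => /h ->.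
case: (ltnP i (n + n)) => [iN|Ni].
  by have /implyP/(_ ci)/eqP := h (Ordinal iN).
by have := ltn_ord p; have := ltn_ord q; lia.
Qed.

Lemma same_block_refl p : same_block p p. Proof. exact/same_blockP. Qed.

Lemma same_block_sym p q : same_block p q = same_block q p.
Proof. by apply/same_blockP/same_blockP => h i /h. Qed.

Lemma exists_lt_sum (I : finType) (P : pred I) (f g : I -> int) :
  \sum_(p | P p) f p < \sum_(p | P p) g p -> exists2 p, P p & f p < g p.
Proof.
case: (boolP [exists p, P p && (f p < g p)]) => [/existsP[p /andP[]]|]; first by exists p.
rewrite negb_exists => /forallP h; rewrite ltNge ler_sum // => p Pp.
by have := h p; rewrite Pp -leNgt.
Qed.

Lemma pcount_cat X (a i : nat) m : (a <= i)%N ->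
  pcount X i m = pcount X a m + \sum_(p < n + n | (a <= p < i)%N) fl (X p) m.
Proof.
move=> ai; rewrite /pcount (bigID (fun p : 'I_(n + n) => (p < a)%N)) /=.
by congr (_ + _); apply: eq_bigl => p; lia.
Qed.

Hypothesis n_gt0 : (0 < n)%N.

Let N_gt0 : 0 < N. Proof. lia. Qed.

Lemma sorted_flr X p q m : sorted_loop X -> (p < q)%N -> same_block p q ->
  fl (X q) m <= fl (X p) m <= fl (X q) m + 1.
Proof.
move=> sX pq spq; have := flr_bounds N_gt0 (X p) (X q); rewrite (sX _ _ pq spq) => h.
apply/andP; split; first by apply: le_flr1 => //; lia.
have : fl (X p + N * 1) m <= fl (X q) m by apply: le_flr1 => //; lia.
by rewrite flr_shiftl //; lia.
Qed.

(** This mirror symmetry is why cuts up to the middle suffice. *)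
Lemma pcount_rev_diff X Y i m : symm X -> symm Y -> residue_inj X -> residue_inj Y ->
  (i <= n + n)%N ->
  pcount X (n + n - i) m - pcount Y (n + n - i) m
  = pcount X i (N - 2 - m) - pcount Y i (N - 2 - m).
Proof.
move=> yX yY iX iY iN; rewrite !pcount_rev // !pcount_full //.
by set S := \sum_(_ < _) _; lia.
Qed.

Hypotheses (cut0 : cut 0)
  (cut_sym : forall i, (i <= n + n)%N -> cut (n + n - i)%N = cut i).

Lemma same_block_rev p q : same_block p q -> same_block (rev_ord p) (rev_ord q).
Proof.
move=> /same_blockP h; apply/same_blockP => i ci /=; have := ltn_ord p; have := ltn_ord q.
case: (leqP i (n + n)) => iN; last by lia.
by have := h (n + n - i)%N; rewrite cut_sym // => /(_ ci); lia.
Qed.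

(** Inside a block the terms [fl (X p) m] decrease by at most one in total.
    If the comparison failed at [i], some term of [X] before [i] would be smaller
    than that of [Y], and some term of [X] after [i] larger than that of [Y];
    a total variation of one leaves no room for both. *)
Lemma cut_leW X Y : symm X -> symm Y -> residue_inj X -> residue_inj Y ->
  sorted_loop X -> sorted_loop Y -> cut_le X Y ->
  forall i, (i <= n + n)%N -> forall m, pcount Y i m <= pcount X i m.
Proof.
move=> yX yY iX iY sX sY le i iN m.
have cN : cut (n + n)%N by have := cut_sym (leq0n (n + n)); rewrite subn0 => ->.
have exa : exists a, cut a && (a <= i)%N by exists 0%N; rewrite cut0.
have exb : exists b, cut b && (i <= b)%N by exists (n + n)%N; rewrite cN.
have [a /andP[ca ai] amax] := ex_maxnP exa (m := i) ltac:(by move=> a /andP[]).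
have [b /andP[cb ib] bmin] := ex_minnP exb.
have bN : (b <= n + n)%N by apply: bmin; rewrite cN.
have sb_ab p q : (a <= p < b)%N -> (a <= q < b)%N -> same_block p q.
  move=> hp hq; apply/same_blockP => i' ci'.
  case: (leqP i' i) => hi.
    by have := amax i'; rewrite ci' hi => /(_ isT); lia.
  by have := bmin i'; rewrite ci' (ltnW hi) => /(_ isT); lia.
rewrite leNgt; apply/negP => lt.
have la := le a ltac:(lia) ca m.
have lb := le b bN cb m.
have [p hp lp] : exists2 p : 'I_(n + n), (a <= p < i)%N & fl (X p) m < fl (Y p) m.
  apply: exists_lt_sum; have := pcount_cat X m ai; have := pcount_cat Y m ai.
  by set u := \sum_(_ < _ | _) _; set w := \sum_(_ < _ | _) _; lia.
have [q hq lq] : exists2 q : 'I_(n + n), (i <= q < b)%N & fl (Y q) m < fl (X q) m.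
  apply: exists_lt_sum; have := pcount_cat X m ib; have := pcount_cat Y m ib.
  by set u := \sum_(_ < _ | _) _; set w := \sum_(_ < _ | _) _; lia.
have pq : (p < q)%N by lia.
have spq : same_block p q by apply: sb_ab; lia.
by have := sorted_flr m sX pq spq; have := sorted_flr m sY pq spq; lia.
Qed.

Lemma cut_le_half X Y : symm X -> symm Y -> residue_inj X -> residue_inj Y ->
  (forall i, (i <= n)%N -> cut i -> forall m, pcount Y i m <= pcount X i m) ->
  cut_le X Y.
Proof.
move=> yX yY iX iY h i iN ci m; case: (leqP i n) => hi; first exact: h.
have := @pcount_rev_diff X Y (n + n - i) m yX yY iX iY (leq_subr _ _).
rewrite subKn // => e.
have := h (n + n - i)%N ltac:(lia); rewrite cut_sym // => /(_ ci (N - 2 - m)).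
by lia.
Qed.

(** Two values of a block keep their rounded-down distance unless one of
    them passes the other. The hypotheses exclude this for a moved and an unmoved
    value; two values of one block that both move either move in parallel or are
    mirror images of each other, which is where the centres of symmetry
    matter. *)
Lemma sym_exch_sorted X j k r : symm X -> residue_inj X -> sorted_loop X -> j != k ->
  X j <= X k + N * r ->
  ~~ same_block j k -> ~~ same_block j (rev_ord j) ->
  (forall q, same_block j q -> q != j -> q != rev_ord k -> ~~ hit (X q) (X j) (X k + N * r)) ->
  (k != rev_ord j -> forall q, same_block k q -> q != k -> q != rev_ord j -> q != rev_ord k ->
     ~~ hit (X q) (X j) (X k + N * r)) ->
  (k != rev_ord j -> same_block k (rev_ord k) -> mirror_gap n (X k + N * r)
    = mirror_gap n (X j)) ->
  sorted_loop (sym_exch X j k r).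
Proof.
move=> yX iX sX jk up njk njj hj hk hphi.
have yX' := sym_exch_symm n_gt0 r yX jk; have iX' := sym_exch_inj n_gt0 (r := r) iX jk.
set X' := sym_exch X j k r in yX' iX' *.
pose P p q := fl (X' p) (X' q) = fl (X p) (X q).
have Psym p q : p != q -> P p q -> P q p.
  move=> pq; rewrite /P => e.
  rewrite (flr_anti N_gt0 (a := X' p)); last by move=> t /iX' /eqP; rewrite (negPf pq).
  by rewrite e [RHS](flr_anti N_gt0) // => t /iX /eqP; rewrite (negPf pq).
have Prev p q : P (rev_ord q) (rev_ord p) -> P p q.
  by rewrite /P !yX !yX' !flr_refl2.
have moved p q : ~~ hit (X q) (X j) (X k + N * r) -> q != j -> q != k ->
   fl (X k + N * r) (X q) = fl (X j) (X q).
  move=> nh qj qk; have := hitPn N_gt0 nh up => e.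
  have -> : fl (X j) (X q) = -1 - fl (X q) (X j).
    by apply: flr_anti => // t /iX/eqP; rewrite (negPf qj).
  rewrite e; apply: flr_anti => // t e'; move/eqP: qk; apply.
  by apply: (iX _ _ (t + r)); lia.
(* By antisymmetry and by the mirror symmetry it suffices to treat pairs whose
   first member is [j] or [k]. *)
have base p q : (p == j) || ((p == k) && (k != rev_ord j)) -> p != q -> same_block p q -> P p q.
  case/orP => [/eqP ->|/andP[/eqP -> kj]] pq spq; rewrite /P /X'.
    have qk : q != k by apply: contraNneq njk => <-.
    have qj : q != rev_ord j by apply: contraNneq njj => <-.
    rewrite eq_sym in pq; rewrite sym_exch_l.
    case: (eqVneq q (rev_ord k)) => [e|qk'].
      have kj : k != rev_ord j by apply: contraNneq pq => kj; rewrite e kj rev_ordK.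
      by rewrite e (sym_exch_symm n_gt0 r yX jk) sym_exch_r // yX /flr; congr (_ %/ _)%Z; lia.
    by rewrite sym_exch_other //; apply: moved => //; apply: hj.
  rewrite eq_sym in pq; rewrite sym_exch_r //.
  have qj : q != j by apply: contraNneq njk => <-; rewrite same_block_sym.
  case: (eqVneq q (rev_ord j)) => [e|qj'].
    by rewrite e (sym_exch_symm n_gt0 r yX jk) sym_exch_l yX /flr; congr (_ %/ _)%Z; lia.
  case: (eqVneq q (rev_ord k)) => [e|qk'].
    rewrite e (sym_exch_symm n_gt0 r yX jk) sym_exch_r // yX -!/(mirror_gap n _).
    have := hphi kj; rewrite -e => /(_ spq).
    by rewrite -mulrN !mirror_shift //; lia.
  rewrite sym_exch_other // -mulrN flr_shiftl // -(moved p) ?flr_shiftl //; first by lia.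
  exact: hk.
have all p q : p != q -> same_block p q -> P p q.
  move=> pq spq; have qp : q != p by rewrite eq_sym.
  have rpq : rev_ord p != rev_ord q by rewrite (inj_eq rev_ord_inj).
  have rqp : rev_ord q != rev_ord p by rewrite eq_sym.
  have sqp : same_block q p by rewrite same_block_sym.
  have sr := same_block_rev spq; have sr' := same_block_rev sqp.
  case: (boolP ((p == j) || ((p == k) && (k != rev_ord j)))) => bp; first exact: base.
  case: (boolP ((q == j) || ((q == k) && (k != rev_ord j)))) => bq; first by apply/Psym/base.
  case: (boolP ((rev_ord p == j) || ((rev_ord p == k) && (k != rev_ord j)))) => bp'.
    by apply/Prev/Psym/base.
  case: (boolP ((rev_ord q == j) || ((rev_ord q == k) && (k != rev_ord j)))) => bq'.
    by apply/Prev/base.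
  have un l : ~~ ((l == j) || ((l == k) && (k != rev_ord j))) ->
      ~~ ((rev_ord l == j) || ((rev_ord l == k) && (k != rev_ord j))) -> X' l = X l.
    rewrite !rev_eq !negb_or => /andP[l1 l2] /andP[l3 l4]; apply: sym_exch_other => //.
      by case: eqVneq l2 l3 => //= -> /negbNE/eqP ->; rewrite eqxx.
    case: (eqVneq l (rev_ord k)) l4 => //= e; rewrite negbK => /eqP kj.
    by move: l1; rewrite e kj rev_ordK eqxx.
  by rewrite /P !un.
by move=> p q pq spq; rewrite all ?sX // -val_eqE /= ltn_eqF.
Qed.

End Blocks.

(** * Where two comparable loops differ *)

Section Step.
Variables (n : nat) (n_gt0 : (0 < n)%N).
Local Notation N := (Posz (n + n)).
Local Notation fl := (flr N).
Local Notation hit := (hit N).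
Local Notation loop := {ffun 'I_(n + n) -> int}.
Implicit Types (p q j k l : 'I_(n + n)) (r m t z : int) (i a b : nat).

Let N_gt0 : 0 < N. Proof. lia. Qed.

Lemma offset_eq x y t : 0 <= y + N * t - x < N -> offset N x y = y + N * t - x.
Proof.
move=> h; have [s e hs] := offsetP N_gt0 x y.
have : N * (s - t) < N * 1 by lia.
have : N * -1 < N * (s - t) by lia.
rewrite !ltr_pM2l // => h1 h2; have st : s = t by lia.
by move: e; rewrite st; lia.
Qed.

(** At most one residue is hit at a given [z]. *)
Lemma pcount_jump (X : loop) i z : residue_inj X ->
  pcount X i z = pcount X i (z - 1)
    + [exists p : 'I_(n + n), (p < i)%N && hit (X p) (z - 1) z]%:Z.
Proof.
move=> iX; have hz y : hit y (z - 1) z -> exists t, y + N * t = z.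
  by move/(hitP N_gt0) => [t ht]; exists t; lia.
case: existsP => [[p0 /andP[p0i hp0]]|h].
  rewrite /pcount (bigD1 p0) //= [X in _ = X + _](bigD1 p0) //=.
  rewrite [X in _ + X = _](eq_bigr (fun p => fl (X p) (z - 1))); last first.
    move=> p /andP[_ pp0]; apply/esym/hitPn => //; last by lia.
    apply/negP => /hz[t et]; have [s es] := hz _ hp0; move/eqP: pp0; apply.
    by apply: (iX _ _ (s - t)); lia.
  have -> : fl (X p0) z = fl (X p0) (z - 1) + 1.
    have [t <-] := hz _ hp0; have -> : X p0 + N * t - 1 = X p0 - 1 + N * t by lia.
    rewrite !flr_shiftr //; have -> : fl (X p0) (X p0) = 0 by apply: flr_eq => //; lia.
    have -> : fl (X p0) (X p0 - 1) = -1 by apply: flr_eq => //; lia.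
    lia.
  by set S := \sum_(_ < _ | _) _; lia.
rewrite addr0; apply: eq_bigr => p pi; apply/esym/hitPn => //; last by lia.
by apply/negP => hp; apply: h; exists p; rewrite pi.
Qed.

Variables (X Y : loop).
Hypotheses (yX : symm X) (yY : symm Y) (iX : residue_inj X) (iY : residue_inj Y).
(** How far [X] is below [Y] in the order, at prefix size [i]. *)
Definition excess i m : int := pcount X i m - pcount Y i m.

Lemma excess_period i m t : (i <= n + n)%N -> excess i (m + N * t) = excess i m.
Proof. by move=> iN; rewrite /excess !pcount_period //; lia. Qed.

Lemma excess_rev i m : (i <= n + n)%N -> excess (n + n - i) m = excess i (N - 2 - m).
Proof. by move=> iN; apply: pcount_rev_diff. Qed.

Lemma excess_ord i m : (i <= n + n)%N -> exists m' : 'I_(n + n), excess i m = excess i m'%:Z.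
Proof.
move=> iN; have h0 : 0 <= (m %% N)%Z by apply: modz_ge0; lia.
have h1 := ltz_pmod m N_gt0; have h2 : (`|(m %% N)%Z|%N < n + n)%N by lia.
exists (Ordinal h2); rewrite /= gez0_abs //.
by rewrite -(excess_period (m %% N)%Z (m %/ N)%Z iN); congr excess; have := divz_eq m N; lia.
Qed.

Definition unequal i : bool := [exists m : 'I_(n + n), excess i m%:Z != 0].

Lemma unequalP i m : (i <= n + n)%N -> ~~ unequal i -> excess i m = 0.
Proof.
move=> iN /existsPn h; have [m' ->] := excess_ord m iN.
by have := h m'; rewrite negbK => /eqP.
Qed.

(** By periodicity a zero can be found above any given nonzero place. *)
Lemma drop_at i : (i <= n + n)%N -> unequal i -> (exists m, excess i m = 0) ->
  exists z, excess i (z - 1) != 0 /\ excess i z = 0.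
Proof.
move=> iN /existsP[m2 h2] [m1 h1].
(* shifting by [K] periods takes the nonzero place below [m1] *)
pose K := `|m1| + 1; pose m0 := m2%:Z + N * (- K).
have h0 : excess i m0 != 0 by rewrite excess_period.
have m01 : m0 <= m1.
  rewrite /m0; have := ltn_ord m2; have h : 0 <= (N - 1) * (K - 1); last by lia.
  by apply: mulr_ge0; lia.
have exc : exists c, excess i (m0 + c%:Z) == 0.
  exists `|m1 - m0|%N; have -> : m0 + `|m1 - m0|%N%:Z = m1 by lia.
  by rewrite h1.
have [c /eqP c0 cmin] := ex_minnP exc.
have c_gt0 : (0 < c)%N.
  by rewrite lt0n; apply: contraNneq h0 => e; move: c0; rewrite e addr0 => ->.
exists (m0 + c%:Z); split=> //; apply/negP => e.
have := cmin c.-1; have -> : m0 + c.-1%:Z = m0 + c%:Z - 1 by lia.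
by rewrite e => /(_ isT); lia.
Qed.

Variable cut : pred nat.
Hypotheses (cut0 : cut 0)
  (cut_sym : forall i, (i <= n + n)%N -> cut (n + n - i)%N = cut i).
Hypothesis (leXY : cut_le cut X Y).

Lemma excess_ge0 i m : (i <= n + n)%N -> cut i -> 0 <= excess i m.
Proof. by move=> iN ci; rewrite subr_ge0; apply: leXY. Qed.

Lemma first_unequal_cut : (exists i m, [/\ (i <= n + n)%N, cut i & excess i m != 0]) ->
  exists a b, [/\ (a < b <= n)%N, cut a, cut b &
    [/\ forall i, cut i -> (i <= a)%N \/ (b <= i)%N,
        forall m, excess a m = 0 & unequal b]].
Proof.
move=> [i [m [iN ci ne]]].
have exb : exists b, [&& (b <= n)%N, cut b & unequal b].
  have [m' e] := excess_ord m iN.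
  case: (leqP i n) => hi.
    by exists i; rewrite hi ci; apply/existsP; exists m'; rewrite -e.
  exists (n + n - i)%N; rewrite cut_sym // ci andTb.
  have [m1 e1] := @excess_ord (n + n - i) (N - 2 - m) (leq_subr _ _).
  apply/andP; split; first lia; apply/existsP; exists m1; rewrite -e1 excess_rev //.
  by have -> : N - 2 - (N - 2 - m) = m by lia.
have [b /and3P[bn cb ub] bmin] := ex_minnP exb.
have b0 : (0 < b)%N.
  rewrite lt0n; apply: contraTneq ub => ->; apply/existsPn => m'.
  by rewrite /excess !pcount0 eqxx.
have exa : exists a, cut a && (a < b)%N by exists 0%N; rewrite cut0.
have [a /andP[ca ab] amax] := ex_maxnP exa (m := b) ltac:(by move=> a /andP[_ /ltnW]).
exists a, b; split=> //; first by rewrite ab.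
split=> // [i' ci'|m'].
  by case: (leqP b i') => hi; [right|left; apply: amax; rewrite ci'].
apply: unequalP; first by lia.
apply/negP => ua; have := bmin a; rewrite ca ua; lia.
Qed.


(** The target [z] comes with the reason why the excess is positive below
    it. If the excess at [b] never vanishes, the next position [b] provides [z].
    Otherwise take a place [z] where the excess at [b] drops to zero: there [Y]
    takes a value in the block [a, b[ while [X] takes none on the first [b]
    positions; as the counts agree at [a] and, by symmetry, at [N - a], the value
    [z] of [X] sits at a position in [b, N - a[. *)
Lemma available_value a b : (a < b <= n)%N -> cut a -> cut b ->
  (forall m, excess a m = 0) -> unequal b ->
  exists (k0 : 'I_(n + n)) z, [/\ (b <= k0 < n + n - a)%N, exists t, z = X k0 + N * t &
    (k0 = b :> nat /\ forall m, excess b m != 0) \/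
    exists (p0 : 'I_(n + n)) t, (a <= p0 < b)%N /\ z = Y p0 + N * t].
Proof.
move=> /andP[ab bn] ca cb ea ub.
case: (boolP [forall m : 'I_(n + n), excess b m%:Z != 0]) => [/forallP h|].
  have bN : (b < n + n)%N by lia.
  exists (Ordinal bN), (X (Ordinal bN)); split => /=; [lia|by exists 0; lia|left].
  by split=> // m; have [m' ->] := @excess_ord b m (ltnW bN).
rewrite negb_forall => /existsP[m1]; rewrite negbK => /eqP e1.
have bN : (b <= n + n)%N by lia.
have [z [ne0 eq0]] := drop_at bN ub (ex_intro _ _ e1).
have exc0 := @excess_ge0 b (z - 1) bN cb.
have := pcount_jump b z iX; have := pcount_jump b z iY.
case: existsP => [[p0 /andP[p0b hp0]] eY|_ eY]; last first.
  by move: ne0 eq0 exc0; rewrite /excess; case: existsP => _ /=; lia.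
case: existsP => [_|noX _] /=; first by move: eY ne0 eq0 exc0; rewrite /excess /=; lia.
have noX' p : (p < b)%N -> ~~ hit (X p) (z - 1) z.
  by move=> pb; apply/negP => hp; apply: noX; exists p; rewrite pb.
have hz y : hit y (z - 1) z -> exists t, z = y + N * t.
  by move/(hitP N_gt0) => [t ht]; exists t; lia.
have ap0 : (a <= p0)%N.
  rewrite leqNgt; apply/negP => p0a.
  have := pcount_jump a z iX; have := pcount_jump a z iY.
  have -> : [exists p : 'I_(n + n), (p < a)%N && hit (Y p) (z - 1) z].
    by apply/existsP; exists p0; rewrite p0a.
  have -> : [exists p : 'I_(n + n), (p < a)%N && hit (X p) (z - 1) z] = false.
    by apply/existsP => -[p /andP[pa]]; apply/negP/noX'; lia.
  by have := ea z; have := ea (z - 1); rewrite /excess /=; lia.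
have ea' m : excess (n + n - a) m = 0 by rewrite excess_rev ?ea //; lia.
have := pcount_jump (n + n - a) z iX; have := pcount_jump (n + n - a) z iY.
have -> : [exists p : 'I_(n + n), (p < n + n - a)%N && hit (Y p) (z - 1) z].
  by apply/existsP; exists p0; rewrite hp0 andbT; lia.
case: existsP => [[k0 /andP[k0a hk0]] _ _|_]; last first.
  by have := ea' z; have := ea' (z - 1); rewrite /excess /=; lia.
exists k0, z; split; last by right; have [t et] := hz _ hp0; exists p0, t; rewrite ap0 p0b.
  by rewrite k0a andbT leqNgt; apply/negP => /noX'; rewrite hk0.
exact: hz.
Qed.

Lemma nearest_below a b (k0 : 'I_(n + n)) z : (a < b <= n)%N -> ~~ (a <= k0 < b)%N ->
  (exists t, z = X k0 + N * t) ->
  exists (j : 'I_(n + n)) t, [/\ (a <= j < b)%N, X j < z + N * t < X j + N &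
    forall l, (a <= l < b)%N -> ~~ hit (X l) (X j) (z + N * t)].
Proof.
move=> /andP[ab bn] k0ab [s ez].
have aN : (a < n + n)%N by lia.
have Pa : (fun p : 'I_(n + n) => a <= p < b)%N (Ordinal aN) by rewrite /= leqnn.
(* [j] carries the value of the block that is closest to [z] from below, and
   [t] shifts [z] by whole periods next to [X j]. *)
case: (@arg_minnP _ (Ordinal aN) (fun p : 'I_(n + n) => a <= p < b)%N
  (fun p => `|offset N (X p) z|%N) Pa) => j hj jmin.
have [t et /andP[o0 oN]] := offsetP N_gt0 (X j) z.
have o1 : offset N (X j) z != 0.
  apply/eqP => e; have : k0 = j by apply: (iX (t := - (s + t))); lia.
  by move=> e'; move: k0ab; rewrite e' hj.
exists j, t; split=> //; first by lia.
move=> l hl; apply/negP => /(hitP N_gt0)[u hu].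
have := jmin l hl.
have [t' et' /andP[o0' oN']] := offsetP N_gt0 (X l) z.
have : offset N (X l) z = z + N * (t - u) - X l by apply: offset_eq; lia.
by lia.
Qed.

(** On the first [i] positions [X] takes no value in ]X j, z], except those
    on the first [a] positions, where the counts agree. If [Y] takes the value
    [z] in the block, going down from [z] therefore keeps the excess positive. If
    [z] comes from position [b] instead, only the cut [b] is concerned. *)
Lemma excess_interval : (exists i m, [/\ (i <= n + n)%N, cut i & excess i m != 0]) ->
  exists a b (j k0 : 'I_(n + n)) z,
  [/\ (a <= j < b)%N && (b <= n)%N, cut a /\ cut b, forall i, cut i -> (i <= a)%N \/ (b <= i)%N,
   (b <= k0 < n + n - a)%N &
   [/\ X j < z < X j + N, hit (X k0) (X j) z,
    forall l, (a <= l < b)%N -> ~~ hit (X l) (X j) z &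
    forall i, (b <= i <= n + n)%N -> cut i ->
      (forall l, (b <= l < i)%N -> ~~ hit (X l) (X j) z) ->
      forall m, X j <= m < z -> 0 < excess i m]].
Proof.
move=> /first_unequal_cut[a [b [hab ca cb [nocut ea ub]]]].
have [k0 [z [hk0 ez hz]]] := available_value hab ca cb ea ub.
have nk0 : ~~ (a <= k0 < b)%N by lia.
have [j [t [hj hjz nohit]]] := nearest_below hab nk0 ez.
have hitk0 : hit (X k0) (X j) (z + N * t).
  by case: ez => s es; apply/(hitP N_gt0); exists (s + t); lia.
exists a, b, j, k0, (z + N * t); split=> //; first by lia.
split=> // i /andP[bi iN] ci nohit' m /andP[m1 m2].
have ge0 z' : 0 <= excess i z' by apply: excess_ge0.
case: hz => [[ek0 ne]|[p0 [s [hp0 ep0]]]].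
  have ib : i = b.
    apply/eqP; rewrite eqn_leq bi andbT leqNgt; apply/negP => lt.
    by have := nohit' k0; rewrite ek0 leqnn lt hitk0 => /(_ isT).
  by have := ge0 m; have := ne m; rewrite -ib; lia.
have ai : (a <= i)%N by lia.
have eX : pcount X i (z + N * t) - pcount X i m = pcount X a (z + N * t) - pcount X a m.
  rewrite !(pcount_cat X _ ai).
  rewrite [X in _ + X - _](eq_bigr (fun p => fl (X p) m)).
    by set S := \sum_(_ < _ | _) _; lia.
  move=> p hp; apply/esym/hitPn => //; last by lia.
  have : ~~ hit (X p) (X j) (z + N * t).
    by case: (ltnP p b) => pb; [apply: nohit|apply: nohit']; lia.
  by apply: contra => /(hitP N_gt0)[u hu]; apply/(hitP N_gt0); exists u; lia.
have eY : pcount Y i (z + N * t) - pcount Y i m >= pcount Y a (z + N * t) - pcount Y a m + 1.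
  rewrite !(pcount_cat Y _ ai).
  have hp0i : (a <= p0 < i)%N by lia.
  rewrite (bigD1 p0) //= [X in _ <= _ - (_ + X)](bigD1 p0) //=.
  have : \sum_(p < n + n | (a <= p < i)%N && (p != p0)) fl (Y p) m
     <= \sum_(p < n + n | (a <= p < i)%N && (p != p0)) fl (Y p) (z + N * t).
    by apply: ler_sum => p _; apply: le_flr2 => //; lia.
  have : fl (Y p0) m < fl (Y p0) (z + N * t).
    by apply/(hitP N_gt0); exists (s + t); lia.
  set S := \sum_(_ < _ | _) _; set S' := \sum_(_ < _ | _) _.
  lia.
by have := ge0 (z + N * t); have := ea m; have := ea (z + N * t); rewrite /excess; lia.
Qed.

End Step.

(** * The covering step *)

Section Cover.
Variables (n : nat) (n_gt0 : (0 < n)%N).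
Local Notation N := (Posz (n + n)).
Local Notation fl := (flr N).
Local Notation hit := (hit N).
Local Notation loop := {ffun 'I_(n + n) -> int}.
Implicit Types (p q j k l : 'I_(n + n)) (r m t z : int) (i a b : nat).

Let N_gt0 : 0 < N. Proof. lia. Qed.

Lemma hit_offset x y z : hit y x z -> x + offset N x y <= z.
Proof.
by move=> /(hitP N_gt0)[t ht]; have := offset_min N_gt0 (x := x) (y := y) (t := t); lia.
Qed.

Lemma offset_ge0 x y : 0 <= offset N x y.
Proof. by have [t _ /andP[]] := offsetP N_gt0 x y. Qed.

(** Raising the start [x] by at most one period loses at most one
    representative. *)
Lemma flr_drop x v m : x <= v <= x + N ->
  fl v m = fl x m \/ fl v m = fl x m - 1 /\ exists t, x <= m + N * t < v.
Proof.
move=> h; have h1 := flr_bounds N_gt0 x m; have h2 := flr_bounds N_gt0 v m.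
have up : fl v m <= fl x m by apply: le_flr1 => //; lia.
have lo : fl x m - 1 <= fl v m.
  have : fl (x + N * 1) m <= fl v m by apply: le_flr1 => //; lia.
  by rewrite flr_shiftl //; lia.
case: (ltrP (fl v m) (fl x m)) => lt; [right|left; lia].
have e : fl v m = fl x m - 1 by lia.
by split=> //; exists (- fl x m); rewrite e in h2; lia.
Qed.

Lemma pcount_sym_exch (X : loop) j k r i m : symm X -> (j < k)%N -> k != rev_ord j ->
  pcount (sym_exch X j k r) i m = pcount X i m
    + (if (j < i <= k)%N then fl (X k + N * r) m - fl (X j) m else 0)
    + (if (rev_ord k < i <= rev_ord j)%N
       then fl (X k + N * r) (N - 2 - m) - fl (X j) (N - 2 - m) else 0).
Proof.
move=> yX jk kj; have jk' : j != k by rewrite -val_eqE /= ltn_eqF.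
have kj' : rev_ord k != j by rewrite rev_eq.
have jk2 : rev_ord j != k by rewrite eq_sym.
rewrite sym_exch_exch // pcount_exch //=; last by have := ltn_ord k; lia.
rewrite pcount_exch // exch_other ?rev_neq // exch_other ?rev_neq //; congr (_ + _).
rewrite !yX flr_shiftl // !flr_refl // flr_shiftl //.
by case: ifP => _ //; lia.
Qed.

Variable cut : pred nat.
Hypotheses (cut0 : cut 0)
  (cut_sym : forall i, (i <= n + n)%N -> cut (n + n - i)%N = cut i).
Variables (X Y : loop).
Hypotheses (yX : symm X) (yY : symm Y) (iX : residue_inj X) (iY : residue_inj Y).
Hypotheses (sX : sorted_loop cut X) (leXY : cut_le cut X Y).

(** One covering step from [X] towards [Y]. The conditions [j < k] and
    [X j < X k + N * r] express that the reflection goes up. *)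
Definition good_step j k r : Prop :=
  [/\ (j < k)%N, X j < X k + N * r, sorted_loop cut (sym_exch X j k r),
      cut_le cut (sym_exch X j k r) Y & len2 (sym_exch X j k r) = len2 X + 2].

(** The block of [l] is not after the block of [k]. *)
Definition not_after k l : Prop := forall i, cut i -> (i <= l)%N -> (i <= k)%N.

(** The data on which a covering step operates: [a, b[ is the block of
    [j], the new value of [j] is [X k + N * r], and [site_free] records that [k]
    was chosen in the first possible block and with the least possible value
    there. *)
Record site a b j k r : Prop := Site {
  site_j : (a <= j < b)%N;
  site_b : (b <= n)%N;
  site_k : (b <= k < n + n - a)%N;
  site_cuts : cut a /\ cut b;
  site_block : forall i, cut i -> (i <= a)%N \/ (b <= i)%N;
  site_up : X j < X k + N * r < X j + N;
  site_own : forall l, (a <= l < b)%N -> ~~ hit (X l) (X j) (X k + N * r);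
  site_free : forall l, (b <= l)%N -> not_after k l -> l != k ->
    ~~ hit (X l) (X j) (X k + N * r);
  site_excess : forall i m, (i <= n + n)%N -> cut i -> (j < i <= k)%N ->
    (exists t, X j <= m + N * t < X k + N * r) -> 0 < excess X Y i m }.

Lemma exists_site : (exists i m, [/\ (i <= n + n)%N, cut i & excess X Y i m != 0]) ->
  exists a b j k r, site a b j k r.
Proof.
move=> /(excess_interval n_gt0 yX yY iX iY cut0 cut_sym leXY).
move=> [a [b [j [k0 [z [/andP[hj bn] [ca cb] nocut /andP[bk0 k0a] [/andP[jz zN] hitk0
  nohitB pos]]]]]]].
(* [k1] is the first candidate position; [k] carries the least candidate value
   in the block of [k1]. *)
pose inK l := (b <= l)%N && hit (X l) (X j) z.
have K0 : inK k0 by rewrite /inK bk0.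
case: (@arg_minnP _ k0 inK val K0) => k1 /andP[bk1 hk1] k1min.
have K1 : inK k1 && same_block cut k1 k1 by rewrite /inK bk1 hk1 same_block_refl.
case: (@arg_minnP _ k1 (fun l => inK l && same_block cut k1 l)
  (fun l => `|offset N (X j) (X l)|%N) K1) => k /andP[/andP[bk hk] /same_blockP sk1k] kmin.
have [r ev /andP[v0 vN]] := offsetP N_gt0 (X j) (X k).
have jk' : j != k by apply/eqP => e; move: hj bk; rewrite e; clear; lia.
have jv : X j < X k + N * r.
  rewrite lt_neqAle -ev lerDl v0 andbT ev; apply: contraNneq jk'.
  by move/iX ->.
have vz : X k + N * r <= z by rewrite -ev; apply: hit_offset.
have ca' : cut (n + n - a)%N.
  by rewrite cut_sym //; move: hj bn; clear; lia.
have k0k1 := k1min k0 K0.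
exists a, b, j, k, r; split=> //.
- rewrite bk /=; have := sk1k _ ca'; move: k0k1 k0a => /=; clear; lia.
- by rewrite jv -ev ltrD2l.
- by move=> l hl; apply: contra (nohitB l hl); apply: hit_le.
- move=> l bl lk nlk; apply/negP => hl.
  have ne t : X l + N * t <> X k + N * r.
    move=> e; move/eqP: nlk; apply; apply: (iX (t := r - t)).
    by move: e; clear; lia.
  have Kl : inK l by rewrite /inK bl (hit_le N_gt0 vz).
  have k1l := k1min l Kl; rewrite /= in k1l.
  have sl : same_block cut k1 l.
    apply/same_blockP => i ci; apply/idP/idP => h; first by move: h k1l; clear; lia.
    by rewrite (sk1k i ci); apply: (lk i ci).
  have := kmin l; rewrite Kl sl => /(_ isT).
  move: hl; rewrite (hit_open N_gt0 _ ne) => /hit_offset.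
  by move: (offset_ge0 (X j) (X l)) ev v0; clear; lia.
- move=> i m iN ci /andP[ji ik] [t ht]; rewrite -(excess_period n_gt0 X Y m t) //.
  have bi : (b <= i)%N by have := nocut i ci; move: hj ji; clear; lia.
  apply: pos => //; [by rewrite bi| |by move: ht vz; clear; lia].
  move=> l /andP[bl li]; apply/negP => hl.
  have Kl : inK l by rewrite /inK bl.
  by have := k1min l Kl; have := sk1k i ci; move: ik li => /=; clear; lia.
Qed.

Lemma site_same a b j k r q : site a b j k r -> same_block cut j q -> (a <= q < b)%N.
Proof.
case=> hj bn _ [ca cb] _ _ _ _ _ /same_blockP h; have := h a ca; have := h b cb.
by move: hj; clear; lia.
Qed.

Lemma site_apart a b j k r : site a b j k r ->
  [/\ (j < k)%N, (j < n)%N, (j < rev_ord j)%N,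
    ~~ same_block cut j k & ~~ same_block cut j (rev_ord j)].
Proof.
move=> s; have hj := site_j s; have bn := site_b s; have hk := site_k s.
split.
- by move: hj hk; clear; lia.
- by move: hj bn; clear; lia.
- by move: hj bn => /=; clear; lia.
- by apply/negP => /(site_same s); move: hk; clear; lia.
- by apply/negP => /(site_same s) /=; move: hj bn; clear; lia.
Qed.

(** The least representative of the mirror image of [X j] lies before the
    value of [k], so it inherits the freeness of the latter up to the middle, and
    by reflection beyond it. *)
Lemma good_step_rev a b j k r : site a b j k r ->
  (forall i, (i <= n)%N -> cut i -> (i <= k)%N) ->
  hit (X (rev_ord j)) (X j) (X k + N * r) ->
  exists r', good_step j (rev_ord j) r'.
Proof.
move=> s reach hrj.
have [jk jn jrj njk njj] := site_apart s.
have [r' ev' /andP[v0' vN']] := offsetP N_gt0 (X j) (X (rev_ord j)).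
have v'v : X (rev_ord j) + N * r' <= X k + N * r by rewrite -ev'; apply: hit_offset.
have jj : j != rev_ord j by rewrite eq_sym rev_neq.
have jv' : X j < X (rev_ord j) + N * r'.
  rewrite lt_neqAle -ev' lerDl v0' andbT ev'; apply: contraNneq jj.
  by move/iX/eqP.
have up : X j < X (rev_ord j) + N * r' < X j + N by rewrite jv' -ev' ltrD2l.
exists r'; split=> //.
- apply: sym_exch_sorted => //; rewrite ?eqxx //; first exact: ltW.
  by move=> q /(site_same s)/(site_own s) h _ _; apply: contra h; apply: hit_le.
- apply: cut_le_half => //; [exact: sym_exch_symm|exact: sym_exch_inj|].
  move=> i hi ci m; rewrite sym_exch_rev pcount_exch //.
  have iN : (i <= n + n)%N by move: hi; clear; lia.
  have e0 := excess_ge0 leXY m iN ci; rewrite /excess in e0.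
  case: ifP => [/andP[ji irj]|_]; last by move: e0; clear; lia.
  have hv : X j <= X (rev_ord j) + N * r' <= X j + N by move: up; clear; lia.
  case: (flr_drop m hv) => [->|[-> [t ht]]]; first by move: e0; clear; lia.
  have : 0 < excess X Y i m.
    apply: (site_excess s) => //; first by rewrite ji reach.
    by exists t; move: ht v'v; clear; lia.
  by rewrite /excess; clear; lia.
- apply: len2_cover_rev => // l /andP[jl lrj].
  have nh l' : (j < l')%N -> (l' < rev_ord j)%N -> (l' < n)%N ->
      ~~ hit (X l') (X j) (X (rev_ord j) + N * r').
    move=> jl' l'j l'n; have hj := site_j s.
    case: (ltnP l' b) => l'b.
      have hl' : (a <= l' < b)%N by move: hj jl' l'b; clear; lia.
      by apply: contra (site_own s hl'); apply: hit_le.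
    case: (eqVneq l' k) => [e|l'k].
      rewrite e; apply/negP => /hit_offset.
      rewrite (offset_eq n_gt0 (t := r)); last by have := site_up s; clear; lia.
      move=> h; have : k = rev_ord j.
        by apply: (iX (t := r' - r)); move: h v'v; clear; lia.
      by move=> e'; move: l'j; rewrite e e' ltnn.
    apply: contra (site_free s l'b _ l'k); first exact: hit_le.
    by move=> i ci il'; apply: reach => //; move: il' l'n; clear; lia.
  case: (ltnP l n) => ln; first exact: nh.
  have : ~~ hit (X (rev_ord l)) (X j) (X (rev_ord j) + N * r').
    by apply: nh; move: jl lrj ln (ltn_ord l) => /=; clear; lia.
  apply: contra => hl; apply: hit_reflect => //.
    move=> t e; have : j = rev_ord l by apply: (iX (t := t)).
    by move=> e'; move: lrj; rewrite e' rev_ordK ltnn.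
  move: hl; rewrite -(rev_ordK l) yX rev_ordK -(hit_shift N_gt0 _ _ _ 0 (- r')).
  by rewrite !yX; congr (hit _ _ _); clear; lia.
Qed.

(** If a centre were passed, the mirror image of [X j] or that of the new
    value would lie in between; the former is excluded by hypothesis and the
    latter by the minimality of the site. *)
Lemma no_centre a b j k r : site a b j k r -> k != rev_ord j ->
  (forall i, (i <= n)%N -> cut i -> (i <= k)%N) ->
  ~~ hit (X (rev_ord j)) (X j) (X k + N * r) ->
  forall c, ~~ (2 * X j < N - 1 + N * c < 2 * (X k + N * r)).
Proof.
move=> s kj reach nh c; apply/negP => hc.
have [jk jn jrj njk njj] := site_apart s.
have gt_v : X k + N * r < N - 1 + N * c - X j.
  rewrite ltNge; apply/negP => h; move/negP: nh; apply; apply/(hitP N_gt0).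
  by exists c; rewrite yX; move: hc h; clear; lia.
have : hit (X (rev_ord k)) (X j) (X k + N * r).
  apply/(hitP N_gt0); exists (c - r); rewrite yX.
  have ne : X (rev_ord k) + N * (c - r) <> X j.
    move=> e; move/eqP: kj; apply; have <- : rev_ord k = j; last by rewrite rev_ordK.
    by apply: (iX (t := - (c - r))); move: e; clear; lia.
  by rewrite yX in ne; move: ne gt_v hc; clear; lia.
have /andP[bk ka] := site_k s.
case: (ltnP (rev_ord k) b) => kb.
  by apply/negP/(site_own s); move: ka kb (ltn_ord k) => /=; clear; lia.
have rkk : rev_ord k != k by exact: rev_neq.
apply/negP/(site_free s) => // i ci ik.
case: (leqP i n) => hi; first exact: reach.
have iN : (i <= n + n)%N by move: ik => /=; clear; lia.
have ci' : cut (n + n - i)%N by rewrite cut_sym.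
have := reach (n + n - i)%N; rewrite ci' => h.
have h' : (n + n - i <= n)%N by move: hi iN; clear; lia.
by move: (h h' isT) ik (ltn_ord k) => /=; clear; lia.
Qed.

(** In a cut between both pairs of positions, the two drops of the count
    are at mirror places; they cannot meet because no centre lies in the
    interval. *)
Lemma good_step_pair a b j k r : site a b j k r ->
  ((forall i, (i <= n)%N -> cut i -> (i <= k)%N) ->
     ~~ hit (X (rev_ord j)) (X j) (X k + N * r)) ->
  good_step j k r.
Proof.
move=> s nh.
have [jk jn jrj njk njj] := site_apart s.
have /andP[bk ka] := site_k s; have up := site_up s.
have /andP[jv vN] := up; have hj := site_j s.
have jk' : j != k by rewrite -val_eqE /= ltn_eqF.
have kj : k != rev_ord j.
  apply/eqP => e.
  have reach i : (i <= n)%N -> cut i -> (i <= k)%N.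
    by move=> hi _; rewrite e; move: hi jn => /=; clear; lia.
  by move/negP: (nh reach); apply; apply/(hitP N_gt0); exists r; rewrite -e jv lexx.
have reachS : same_block cut k (rev_ord k) -> forall i, (i <= n)%N -> cut i -> (i <= k)%N.
  by move=> /same_blockP h i hi /h; move: hi (ltn_ord k) => /=; clear; lia.
have reachn : (n <= k)%N -> forall i, (i <= n)%N -> cut i -> (i <= k)%N.
  by move=> nk i hi _; apply: leq_trans nk.
have nc reach := no_centre s kj reach (nh reach).
have ephi : (forall i, (i <= n)%N -> cut i -> (i <= k)%N) ->
    mirror_gap n (X k + N * r) = mirror_gap n (X j).
  move=> reach; apply/eqP; rewrite eq_le (mirror_le n_gt0 (ltW jv)) /= leNgt.
  by apply/negP => /(mirror_lt n_gt0)[c]; apply/negP/nc.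
split=> //.
- apply: sym_exch_sorted => //; first exact: ltW.
  + by move=> q /(site_same s)/(site_own s).
  + move=> _ q skq qk qj qk'; apply: (site_free s) => //.
      by move/same_blockP: skq => h; have [_ cb] := site_cuts s; rewrite -(h b cb).
    by move=> i ci; move/same_blockP: skq => ->.
  + by move=> _ /reachS.
- apply: cut_le_half => //; [exact: sym_exch_symm|exact: sym_exch_inj|].
  move=> i hi ci m; rewrite pcount_sym_exch //.
  have iN : (i <= n + n)%N by move: hi; clear; lia.
  have e0 := excess_ge0 leXY m iN ci; rewrite /excess in e0.
  have hv : X j <= X k + N * r <= X j + N by rewrite !ltW.
  have e1 : (j < i <= k)%N -> (exists t, X j <= m + N * t < X k + N * r) ->
      0 < excess X Y i m by move=> *; apply: (site_excess s).
  have e2 : (rev_ord k < i <= rev_ord j)%N ->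
      (exists t, X j <= N - 2 - m + N * t < X k + N * r) -> 0 < excess X Y i m.
    move=> hi' ht; have <- : N - 2 - (N - 2 - m) = m by clear; lia.
    rewrite -excess_rev //; apply: (site_excess s) => //.
    - exact: leq_subr.
    - by rewrite cut_sym.
    - by move: hi hi' (ltn_ord k) (ltn_ord j) => /=; clear; lia.
  rewrite /excess in e1 e2.
  case: ifP => h1; case: ifP => h2.
  + have [d1|[d1 [t ht]]] := flr_drop m hv;
    have [d2|[d2 [t' ht']]] := flr_drop (N - 2 - m) hv; rewrite d1 d2.
    * by move: e0; clear; lia.
    * by have := e2 h2 ltac:(by exists t'); clear; lia.
    * by have := e1 h1 ltac:(by exists t); clear; lia.
    have nk : (n <= k)%N by move: h2 hi => /=; clear; lia.
    have /negP[] := nc (reachn nk) (t + t').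
    by move: ht ht'; clear; lia.
  + have [d1|[d1 [t ht]]] := flr_drop m hv; rewrite d1.
      by move: e0; clear; lia.
    by have := e1 h1 ltac:(by exists t); clear; lia.
  + have [d2|[d2 [t' ht']]] := flr_drop (N - 2 - m) hv; rewrite d2.
      by move: e0; clear; lia.
    by have := e2 h2 ltac:(by exists t'); clear; lia.
  by move: e0; clear; lia.
- apply: len2_cover => // [l /andP[jl lk]|kr|nk|nk].
  + case: (ltnP l b) => lb; first by apply: (site_own s); move: hj jl lb; clear; lia.
    apply: (site_free s) => //; last by rewrite -val_eqE /= ltn_eqF.
    by move=> i ci il; apply: leq_trans il (ltnW lk).
  + by apply: (site_own s); move: hj ka kr (ltn_ord k) => /=; clear; lia.
  + by apply: nh; apply: reachn.
  + by apply: ephi; apply: reachn.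
Qed.

Lemma exists_good_step : (exists i m, [/\ (i <= n + n)%N, cut i & excess X Y i m != 0]) ->
  exists j k r, good_step j k r.
Proof.
move=> /exists_site[a [b [j [k [r s]]]]].
case: (boolP ([forall i : 'I_n.+1, cut i ==> (i <= k)%N]
              && hit (X (rev_ord j)) (X j) (X k + N * r))) => [/andP[/forallP reach h]|h].
  have {}reach i : (i <= n)%N -> cut i -> (i <= k)%N.
    by move=> hi ci; have /implyP := reach (Ordinal (hi : (i < n.+1)%N)); apply.
  by have [r' s'] := good_step_rev s reach h; exists j, (rev_ord j), r'.
exists j, k, r; apply: (good_step_pair s) => reach.
move: h; rewrite negb_and => /orP[|//]; rewrite negb_forall => /existsP[i].
by rewrite negb_imply => /andP[ci]; rewrite reach // -ltnS.
Qed.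

End Cover.

(** * Induction along covering steps *)

Section Chain.
Variables (n : nat) (n_gt0 : (0 < n)%N).
Local Notation N := (Posz (n + n)).
Local Notation fl := (flr N).
Local Notation loop := {ffun 'I_(n + n) -> int}.
Implicit Types (X Y : loop) (p q j k l : 'I_(n + n)) (r m t z : int) (i a b : nat).

Let N_gt0 : 0 < N. Proof. lia. Qed.

Lemma pcount_sym_exch_le X j k r i m : symm X -> (j < k)%N -> X j <= X k + N * r ->
  pcount (sym_exch X j k r) i m <= pcount X i m.
Proof.
move=> yX jk up.
have d m' : fl (X k + N * r) m' <= fl (X j) m' by apply: le_flr1.
case: (eqVneq k (rev_ord j)) => [kj|kj].
  rewrite kj sym_exch_rev -kj pcount_exch //.
  by case: ifP => _; have := d m; lia.
rewrite pcount_sym_exch //; have := d m; have := d (N - 2 - m).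
by case: ifP => _; case: ifP => _; lia.
Qed.

Lemma pcount_sym_exch_lt X j k r : symm X -> (j < k)%N -> X j < X k + N * r ->
  pcount (sym_exch X j k r) j.+1 (X j) < pcount X j.+1 (X j).
Proof.
move=> yX jk up.
have d m' : fl (X k + N * r) m' <= fl (X j) m' by apply: le_flr1 => //; exact: ltW.
have e0 : fl (X j) (X j) = 0 by apply: flr_eq => //; lia.
have e1 : fl (X k + N * r) (X j) < 0.
  by rewrite ltNge flr_ge //; lia.
case: (eqVneq k (rev_ord j)) => [kj|kj].
  rewrite kj sym_exch_rev -kj pcount_exch // ltnSn jk /=.
  by lia.
rewrite pcount_sym_exch // ltnSn jk /=.
by case: ifP => _; have := d (N - 2 - X j); lia.
Qed.

Lemma pcount_injective X Y :
  (forall i m, (i <= n + n)%N -> pcount X i m = pcount Y i m) -> X = Y.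
Proof.
move=> e; apply: loop_ext => p.
have f m : fl (X p) m = fl (Y p) m.
  have := pcountS X p m; have := pcountS Y p m.
  by rewrite !e ?(ltnW (ltn_ord p)) //; lia.
have h1 := f (X p); have h2 := f (Y p).
have e1 : fl (X p) (X p) = 0 by apply: flr_eq => //; lia.
have e2 : fl (Y p) (Y p) = 0 by apply: flr_eq => //; lia.
have := flr_bounds N_gt0 (X p) (Y p); have := flr_bounds N_gt0 (Y p) (X p).
by rewrite h2 -h1 e1 e2; lia.
Qed.

Variable cut : pred nat.
Hypotheses (cut0 : cut 0)
  (cut_sym : forall i, (i <= n + n)%N -> cut (n + n - i)%N = cut i).

Definition wf_loop X : Prop := [/\ symm X, residue_inj X & sorted_loop cut X].

(** Induction on the total excess over one period. *)
Lemma cut_le_ind Y (P : loop -> Prop) : wf_loop Y -> P Y ->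
  (forall X j k r, wf_loop X -> good_step cut X Y j k r -> P (sym_exch X j k r) -> P X) ->
  forall X, wf_loop X -> cut_le cut X Y -> P X.
Proof.
move=> [yY iY sY] PY step X.
(* the total excess; an exchange lowers it at prefix size [j.+1], place [Z j] *)
pose mu Z : int :=
  \sum_(im : 'I_(n + n).+1 * 'I_(n + n)) excess Z Y im.1 im.2%:Z.
have mu_ge0 Z : wf_loop Z -> cut_le cut Z Y -> 0 <= mu Z.
  move=> [yZ iZ sZ] le; apply: sumr_ge0 => im _; rewrite subr_ge0.
  by apply: (cut_leW n_gt0 cut0 cut_sym) => //; rewrite -ltnS.
have mu_lt Z j k r : symm Z -> good_step cut Z Y j k r -> mu (sym_exch Z j k r) < mu Z.
  move=> yZ [jk up _ _ _]; rewrite -subr_gt0 -sumrB.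
  have jN : (j.+1 < (n + n).+1)%N by rewrite ltnS.
  have [m e] := @excess_ord n n_gt0 Z (sym_exch Z j k r) j.+1 (Z j) jN.
  rewrite (bigD1 (Ordinal jN, m)) //=; apply: ltr_pwDl.
    by move: (pcount_sym_exch_lt yZ jk up) e; rewrite /excess; lia.
  apply: sumr_ge0 => im _.
  by have := @pcount_sym_exch_le Z j k r im.1 im.2 yZ jk (ltW up); rewrite /excess; lia.
have [M] := ubnP `|mu X|%N; elim: M X => // M IH X hM wX le.
have [yX iX sX] := wX.
case: (boolP [exists im : 'I_(n + n).+1 * 'I_(n + n),
  cut im.1 && (excess X Y im.1 im.2%:Z != 0)]) => [/existsP[[i m] /= /andP[ci ne]]|none].
  have [j [k [r s]]] : exists j k r, good_step cut X Y j k r.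
    by apply: exists_good_step => //; exists i, m%:Z; split=> //; rewrite -ltnS.
  have [jk _ sX' le' _] := s.
  have jk' : j != k by rewrite -val_eqE /= ltn_eqF.
  have wX' : wf_loop (sym_exch X j k r) by split=> //;
    [exact: sym_exch_symm|exact: sym_exch_inj].
  apply: (step X j k r) => //; apply: IH => //.
  by move: (mu_lt X j k r yX s) (mu_ge0 _ wX' le') hM; clear; lia.
suff -> : X = Y by [].
have eq_cut i m : (i <= n + n)%N -> cut i -> excess X Y i m = 0.
  move=> iN ci; have [m' ->] := @excess_ord n n_gt0 X Y i m iN.
  by have := existsPn none (Ordinal (iN : i < (n + n).+1)%N, m'); rewrite /= ci negbK => /eqP.
apply: pcount_injective => i m iN; apply/eqP; rewrite eq_le.
by rewrite !(cut_leW n_gt0 cut0 cut_sym) // => i' i'N ci' m';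
  have := eq_cut i' m' i'N ci'; rewrite /excess; lia.
Qed.

End Chain.

(** * The root system in terms of pairs of chain elements *)

Section Roots.
Variables (R : realType) (n : nat).
Local Notation V := 'rV[R]_n.
Local Notation Cvec := (@Cvec R n).
Local Notation dot := (@dot R n).
Implicit Types (c d e p q : Cn n) (u v : V).

Lemma dotDl u1 u2 v : dot (u1 + u2) v = dot u1 v + dot u2 v.
Proof. by rewrite /dot -big_split; apply: eq_bigr => s _; rewrite mxE mulrDl. Qed.

Lemma dotZl (a : R) u v : dot (a *: u) v = a * dot u v.
Proof. by rewrite /dot mulr_sumr; apply: eq_bigr => s _; rewrite mxE mulrA. Qed.

Lemma dotNl u v : dot (- u) v = - dot u v.
Proof. by rewrite -scaleN1r dotZl mulN1r. Qed.

Lemma dotC u v : dot u v = dot v u.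
Proof. by apply: eq_bigr => s _; rewrite mulrC. Qed.

Lemma dotDr u v1 v2 : dot u (v1 + v2) = dot u v1 + dot u v2.
Proof. by rewrite dotC dotDl !(dotC u). Qed.

Lemma dotNr u v : dot u (- v) = - dot u v.
Proof. by rewrite dotC dotNl dotC. Qed.

Lemma dot0l v : dot 0 v = 0.
Proof. by rewrite /dot big1 // => s _; rewrite mxE mul0r. Qed.

Lemma dot_suml (I : Type) (r : seq I) (P : pred I) (F : I -> V) v :
  dot (\sum_(i <- r | P i) F i) v = \sum_(i <- r | P i) dot (F i) v.
Proof.
by elim/big_rec2: _ => [|i y1 y2 _ <-]; rewrite ?dot0l ?dotDl.
Qed.

Lemma dot_eps (s : 'I_n) v : dot (eps R n s) v = v 0 s.
Proof.
rewrite /dot (bigD1 s) //= mxE eqxx mul1r big1 ?addr0 // => t ts.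
by rewrite mxE (inj_eq val_inj) (negPf ts) mul0r.
Qed.

Lemma Cvec_lshift (s : 'I_n) : Cvec (lshift n s) = eps R n s.
Proof. by rewrite /Defs.Cvec /= ltn_ord. Qed.

Lemma Cvec_rev c : Cvec (rev_ord c) = - Cvec c.
Proof.
rewrite /Defs.Cvec rev_ordK; have := ltn_ord c => cN.
by case: (ltnP c n) => h; rewrite /= ?opprK; case: ltnP => // h'; exfalso; lia.
Qed.

Lemma Cn_cases c : exists s : 'I_n, c = lshift n s \/ c = rev_ord (lshift n s).
Proof.
case: (ltnP c n) => h.
  by exists (Ordinal h); left; apply: val_inj.
have h' : (rev_ord c < n)%N by rewrite /=; have := ltn_ord c; lia.
exists (Ordinal h'); right; apply: rev_ord_inj; rewrite rev_ordK.
exact: val_inj.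
Qed.

(** Vectors are compared through their pairings with the chain elements
    throughout; this treats a basis vector and its opposite alike. *)
Lemma dot_ext u v : (forall c, dot u (Cvec c) = dot v (Cvec c)) -> u = v.
Proof.
move=> h; apply/rowP => s; have := h (lshift n s).
by rewrite Cvec_lshift !(dotC _ (eps _ _ _)) !dot_eps.
Qed.

Lemma dot_Cvec c d : dot (Cvec c) (Cvec d) = (c == d)%:R - (c == rev_ord d)%:R.
Proof.
have aux (s : 'I_n) e : dot (Cvec (lshift n s)) (Cvec e) =
    (lshift n s == e)%:R - (lshift n s == rev_ord e)%:R.
  rewrite Cvec_lshift dot_eps; have [t [->|->]] := Cn_cases e.
    rewrite Cvec_lshift mxE -!val_eqE /=.
    have -> : (nat_of_ord s == n + n - t.+1)%N = false by have := ltn_ord s;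
      have := ltn_ord t; lia.
    by rewrite subr0.
  rewrite Cvec_rev Cvec_lshift rev_ordK !mxE -!val_eqE /=.
  have -> : (nat_of_ord s == n + n - t.+1)%N = false by have := ltn_ord s;
    have := ltn_ord t; lia.
  by rewrite sub0r.
have [s [->|->]] := Cn_cases c; first exact: aux.
by rewrite Cvec_rev dotNl aux opprB !rev_eq rev_ordK.
Qed.

Lemma roots_Cvec c d : c != d -> Cvec c - Cvec d \in Defs.roots R n.
Proof.
move=> cd.
have small (s t : 'I_n) : (s < t)%N -> forall a, a \in [:: eps R n s + eps R n t;
  eps R n s - eps R n t;
    - (eps R n s + eps R n t); - (eps R n s - eps R n t)] -> a \in Defs.roots R n.
  move=> st a ha; rewrite /Defs.roots mem_cat; apply/orP; left.
  apply/allpairsPdep; exists (s, t), a; split=> //.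
  by rewrite mem_enum inE.
have long (s : 'I_n) : forall a, a \in [:: 2 *: eps R n s;
  - (2 *: eps R n s)] -> a \in Defs.roots R n.
  move=> a ha; rewrite /Defs.roots mem_cat; apply/orP; right.
  by apply/allpairsPdep; exists s, a; split=> //; rewrite mem_enum inE.
have [s [es|es]] := Cn_cases c; have [t [et|et]] := Cn_cases d;
  rewrite es et ?Cvec_rev ?Cvec_lshift;
  (case: (ltngtP s t) => [lt|lt|/val_inj e]; [apply: (small _ _ lt)|apply: (small _ _ lt)|]);
  rewrite ?inE -?opprD ?opprB ?opprK;
  try by rewrite ?[eps R n t + eps R n s]addrC ?[- eps _ _ _ + eps _ _ _]addrC ?eqxx ?orbT.
- by move: cd; rewrite es et e eqxx.
- by apply: (long t); rewrite e inE scaler_nat mulr2n eqxx.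
- by apply: (long t); rewrite e !inE scaler_nat mulr2n eqxx orbT.
- by move: cd; rewrite es et e eqxx.
Qed.

(** Writing every root as a difference of two chain elements unifies short
    and long roots: [2 *: eps s] is [Cvec c - Cvec (rev_ord c)]. *)
Lemma rootsP a : a \in Defs.roots R n -> exists c d, c != d /\ a = Cvec c - Cvec d.
Proof.
have ne (s t : 'I_n) : lshift n s != rev_ord (lshift n t).
  by rewrite -val_eqE /=; have := ltn_ord s; have := ltn_ord t; lia.
rewrite /Defs.roots mem_cat => /orP[] /allpairsPdep[].
  move=> [s t] [a' []]; rewrite mem_enum inE /= => st ha' ->.
  have st' : lshift n s != lshift n t by rewrite -val_eqE /= ltn_eqF.
  move: ha'; rewrite !inE => /or4P[] /eqP ->.
  - by exists (lshift n s), (rev_ord (lshift n t)); rewrite Cvec_rev !Cvec_lshift opprK.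
  - by exists (lshift n s), (lshift n t); rewrite !Cvec_lshift.
  - exists (rev_ord (lshift n s)), (lshift n t); rewrite Cvec_rev !Cvec_lshift opprD.
    by rewrite rev_eq; split; rewrite ?ne.
  - by exists (lshift n t), (lshift n s); rewrite !Cvec_lshift opprB eq_sym.
move=> s [a' [_]]; rewrite !inE => /orP[] /eqP -> ->.
- by exists (lshift n s), (rev_ord (lshift n s));
  rewrite Cvec_rev Cvec_lshift opprK scaler_nat mulr2n.
- exists (rev_ord (lshift n s)), (lshift n s);
  rewrite Cvec_rev Cvec_lshift scaler_nat mulr2n opprD.
  by rewrite rev_eq.
Qed.

Lemma simple_root_Cvec (s : 'I_n) p q : p = s :> nat -> q = s.+1 :> nat ->
  simple_root R s = Cvec p - Cvec q.
Proof.
move=> ep eq; rewrite /simple_root /Defs.Cvec ep eq ltn_ord.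
case: ltnP => // sn; rewrite opprK scaler_nat mulr2n; congr (_ + eps _ _ _).
by rewrite /= eq; have := ltn_ord s; lia.
Qed.

(** Consecutive chain elements differ by a simple root, and the step and its
    mirror image give the same one. *)
Lemma Cvec_succ p q : q = p.+1 :> nat -> exists2 s : 'I_n,
  p.+1 = s.+1 \/ p.+1 = (n + n - s.+1)%N & Cvec p - Cvec q = simple_root R s.
Proof.
move=> e; case: (ltnP p n) => h.
  exists (Ordinal h); first by left.
  by rewrite (@simple_root_Cvec (Ordinal h) p q).
have qN := ltn_ord q.
have h' : (rev_ord q < n)%N by rewrite /=; lia.
exists (Ordinal h'); first by right; rewrite /=; lia.
rewrite (@simple_root_Cvec (Ordinal h') (rev_ord q) (rev_ord p)) //=; last by lia.
by rewrite !Cvec_rev opprK addrC.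
Qed.

Lemma simple_root_coroot (s : 'I_n) :
  simple_root R s = (if (s.+1 < n)%N then 1 else 2) *: coroot (simple_root R s).
Proof.
rewrite coroot_simple_root /simple_root; case: ltnP => sn; first by rewrite scale1r.
congr (_ *: _); rewrite -[LHS]subr0; congr (_ - _).
by apply/rowP => t; rewrite !mxE; case: eqP => // e; move: (ltn_ord t); rewrite e ltnNge sn.
Qed.

Lemma free_simple_roots : free (simple_roots R n).
Proof.
apply/freeP => k k0 i.
(* simple roots are nonzero multiples of simple coroots, which are free *)
pose h (j : 'I_n) : R := if (j.+1 < n)%N then 1 else 2.
have hn0 j : h j != 0 by rewrite /h; case: ifP; rewrite ?oner_eq0 ?pnatr_eq0.
have /freeP := free_simple_coroots R n => /(_ (fun j => k j * h j)).
have -> : \sum_j (k j * h j) *: (simple_coroots R n)`_j = 0.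
  rewrite -[RHS]k0; apply: eq_bigr => j _.
  by rewrite -!tnth_nth !tnth_mktuple [in RHS]simple_root_coroot [RHS]scalerA.
by move=> /(_ erefl i)/eqP; rewrite mulf_eq0 (negPf (hn0 i)) orbF => /eqP.
Qed.

Lemma coord_simple_root (i j : 'I_n) : coord (simple_roots R n) i (simple_root R j)
  = (i == j)%:R.
Proof.
have -> : simple_root R j = (simple_roots R n)`_j by rewrite -tnth_nth tnth_mktuple.
by rewrite coord_free ?free_simple_roots // eq_sym.
Qed.

Lemma coordD i u v : coord (simple_roots R n) i (u + v)
  = coord (simple_roots R n) i u + coord (simple_roots R n) i v.
Proof. exact: linearD. Qed.

Lemma coordN i u : coord (simple_roots R n) i (- u) = - coord (simple_roots R n) i u.
Proof. exact: linearN. Qed.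

Lemma coord_Cvec c d i : (c <= d)%N -> 0 <= coord (simple_roots R n) i (Cvec c - Cvec d).
Proof.
move=> cd; move: {2}(d - c)%N (erefl (d - c)%N) => m; elim: m d cd => [|m IH] d cd e.
  have -> : d = c by apply: val_inj => /=; lia.
  by rewrite subrr linear0.
have h : (d.-1 < n + n)%N by have := ltn_ord d; lia.
pose d' : Cn n := Ordinal h.
have [s _ es] := @Cvec_succ d' d ltac:(rewrite /=; lia).
have -> : Cvec c - Cvec d = (Cvec c - Cvec d') + (Cvec d' - Cvec d) by rewrite addrA subrK.
rewrite coordD addr_ge0 //; first by apply: IH; rewrite /=; lia.
by rewrite es coord_simple_root ler0n.
Qed.

Lemma pos_rootsP c d : c != d -> (Cvec c - Cvec d \in pos_roots R n) = (c < d)%N.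
Proof.
move=> cd; rewrite mem_filter roots_Cvec // andbT.
case: (ltnP c d) => h; first by apply/forallP => i; apply/coord_Cvec/ltnW.
have dc : (d < c)%N by rewrite ltn_neqAle eq_sym cd.
have h' : (d.+1 < n + n)%N by apply: leq_ltn_trans (ltn_ord c).
have [s _ es] := @Cvec_succ d (Ordinal h') erefl.
apply/negbTE; rewrite negb_forall; apply/existsP; exists s.
rewrite -ltNge -opprB coordN oppr_lt0.
have -> : Cvec d - Cvec c = (Cvec d - Cvec (Ordinal h')) + (Cvec (Ordinal h')
  - Cvec c) by rewrite addrA subrK.
rewrite coordD es coord_simple_root eqxx ltr_pwDl ?ltr01 //.
exact: coord_Cvec.
Qed.

(** Chain elements differ by less than a period, so the inequality holds for
    all [m > 0] and for no [m < 0]. *)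
Lemma aff_posP c d (m : int) : c != d ->
  aff_pos (Cvec c - Cvec d, m%:~R) <-> c%:Z < d%:Z + (n + n)%:Z * m.
Proof.
move=> cd; rewrite /aff_pos /= pos_rootsP // roots_Cvec //.
have hc := ltn_ord c; have hd := ltn_ord d.
split=> [[[h /eqP]|[_ _]]|h].
- by rewrite intr_eq0 => /eqP ->; lia.
- rewrite ltr0z => m0; have : (n + n)%:Z * 1 <= (n + n)%:Z * m by apply: ler_wpM2l; lia.
  by lia.
- case: (ltrgtP m 0) => m0.
  + have : (n + n)%:Z * m <= (n + n)%:Z * -1 by apply: ler_wpM2l; lia.
    by lia.
  + by right; rewrite ltr0z; split=> //; apply: intr_int.
  + by left; rewrite m0; split=> //; move: h; rewrite m0; lia.
Qed.

(** Up to a factor this is the pairing with a fundamental coweight; it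
    detects the coefficient of one simple root. *)
Definition psum (s : 'I_n) v : R := \sum_(t < n | (t <= s)%N) v 0 t.

Lemma psumD s u v : psum s (u + v) = psum s u + psum s v.
Proof. by rewrite /psum -big_split; apply: eq_bigr => t _; rewrite mxE. Qed.

Lemma psumZ s (a : R) v : psum s (a *: v) = a * psum s v.
Proof. by rewrite /psum mulr_sumr; apply: eq_bigr => t _; rewrite mxE. Qed.

Lemma psumN s v : psum s (- v) = - psum s v.
Proof. by rewrite -scaleN1r psumZ mulN1r. Qed.

Lemma psum_Cvec s c : psum s (Cvec c) = (c <= s)%N%:R - (n + n - s.+1 <= c)%N%:R.
Proof.
have aux (t : 'I_n) : psum s (eps R n t) = (t <= s)%N%:R.
  rewrite /psum; case: leqP => ts.
    rewrite (bigD1 t) //= mxE eqxx big1 ?addr0 // => s' /andP[_ st].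
    by rewrite mxE (inj_eq val_inj) (negPf st).
  rewrite big1 // => s' s's; rewrite mxE; case: eqP => // e.
  by move: s's; rewrite e leqNgt ts.
have [t [->|->]] := Cn_cases c.
  rewrite Cvec_lshift aux /=.
  have -> : (n + n - s.+1 <= t)%N = false by have := ltn_ord s; have := ltn_ord t; lia.
  by rewrite subr0.
rewrite Cvec_rev psumN Cvec_lshift aux /=.
have -> : (n + n - t.+1 <= s)%N = false by have := ltn_ord s; have := ltn_ord t; lia.
have -> : (n + n - s.+1 <= n + n - t.+1)%N = (t <= s)%N by have := ltn_ord s;
  have := ltn_ord t; lia.
by rewrite sub0r.
Qed.

Lemma psum_simple_root (s t : 'I_n) : s != t -> psum s (simple_root R t) = 0.
Proof.
move=> st; have h : (t.+1 < n + n)%N by have := ltn_ord t; lia.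
rewrite (@simple_root_Cvec t (lshift n t) (Ordinal h)) // psumD psumN !psum_Cvec /=.
have ht := ltn_ord t; have hs := ltn_ord s; rewrite -val_eqE /= in st.
have -> : (n + n - s.+1 <= t)%N = false by lia.
have -> : (n + n - s.+1 <= t.+1)%N = false by lia.
have -> : (t.+1 <= s)%N = (t <= s)%N by lia.
by rewrite subrr.
Qed.

(** The step from position [i - 1] to [i] is the simple root of index
    [i - 1] or [N - i - 1], so every element outside [J] gives two mirror cuts,
    which coincide in the middle. *)
Definition cutJ (J : {set 'I_n}) (i : nat) : bool :=
  [|| i == 0%N, i == (n + n)%N |
      [exists s : 'I_n, (s \notin J) && ((i == s.+1) || (i == n + n - s.+1)%N)]].

Lemma cutJ0 J : cutJ J 0. Proof. by []. Qed.

Lemma cutJ_sym J i : (i <= n + n)%N -> cutJ J (n + n - i) = cutJ J i.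
Proof.
move=> iN; rewrite /cutJ orbCA; congr [|| _, _ | _]; [lia|lia|].
apply: eq_existsb => s; congr (_ && _); have := ltn_ord s => sn.
by rewrite orbC; congr (_ || _); lia.
Qed.

(** The expansion of [Cvec c - Cvec d] into consecutive differences involves
    the simple roots at the steps between [c] and [d]. *)
Lemma rootsJP J c d : c != d -> rootsJ J (Cvec c - Cvec d) <-> same_block (cutJ J) c d.
Proof.
move=> cd; split=> [[_ [k ek]]|].
  apply/same_blockP => i /or3P[/eqP ->|/eqP ->|/existsP[s /andP[sJ ei]]].
  - by [].
  - by have := ltn_ord c; have := ltn_ord d; lia.
  have : psum s (Cvec c) = psum s (Cvec d).
    apply/eqP; rewrite -subr_eq0 -psumN -psumD ek.
    rewrite (big_morph _ (psumD s) (_ : psum s 0 = 0));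
      last by rewrite /psum big1 // => t _; rewrite mxE.
    by rewrite big1 // => t tJ; rewrite psumZ psum_simple_root ?mulr0 //;
      apply: contraNneq sJ => ->.
  rewrite !psum_Cvec.
  have hc := ltn_ord c; have hd := ltn_ord d; have hs := ltn_ord s.
  have e1 (e : Cn n) : (n + n - s.+1 <= e)%N -> (e <= s)%N = false by lia.
  case c1 : (n + n - s.+1 <= c)%N; case d1 : (n + n - s.+1 <= d)%N.
  - by move: c1 d1 ei => /=; lia.
  - rewrite (e1 _ c1) sub0r subr0 => /eqP; rewrite eq_sym -subr_eq0 opprK -natrD pnatr_eq0.
    by case: (_ <= _)%N.
  - rewrite (e1 _ d1) sub0r subr0 => /eqP; rewrite -subr_eq0 opprK -natrD pnatr_eq0.
    by case: (_ <= _)%N.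
  - rewrite !subr0 => /eqP; rewrite eqr_nat => e.
    have {}e : (c <= s)%N = (d <= s)%N by move: e; case: (_ <= _)%N; case: (_ <= _)%N.
    by move: c1 d1 e ei => /=; lia.
move=> s; split; first exact: roots_Cvec.
wlog lt : c d cd s / (c < d)%N => [wl|].
  case: (ltngtP c d) => h; first exact: wl.
    have [k ek] := wl d c ltac:(by rewrite eq_sym) ltac:(by rewrite same_block_sym) h.
    exists (fun j => - k j); rewrite -opprB ek -sumrN; apply: eq_bigr => j _.
    by rewrite intrN scaleNr.
  by move: cd; rewrite -val_eqE /= h eqxx.
move: {2}(d - c)%N (erefl (d - c)%N) => m; elim: m d {cd} s lt => [|m IH] d s lt e; first lia.
have h : (d.-1 < n + n)%N by have := ltn_ord d; lia.
pose d' : Cn n := Ordinal h.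
have ed : d = d'.+1 :> nat by rewrite /=; lia.
have [t ht et] := Cvec_succ ed.
have tJ : t \in J.
  apply: contraT => tJ; have ct : cutJ J d.
    apply/or3P/Or33/existsP; exists t; rewrite tJ ed; case: ht => <-; rewrite eqxx ?orbT //.
  by have /same_blockP/(_ _ ct) := s; rewrite leqnn; lia.
have one : exists k : 'I_n -> int, simple_root R t = \sum_(j in J) (k j)%:~R *: simple_root R j.
  exists (fun j => (j == t)%:Z); rewrite (bigD1 t) //= eqxx scale1r big1 ?addr0 //
    => j /andP[_ jt].
  by rewrite (negPf jt) scale0r.
have rest : exists k : 'I_n -> int, Cvec c - Cvec d'
  = \sum_(j in J) (k j)%:~R *: simple_root R j.
  case: (eqVneq c d') => [->|cd'].
    by exists (fun=> 0); rewrite subrr big1 // => j _; rewrite scale0r.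
  rewrite -val_eqE /= in cd'.
  apply: IH; rewrite /=; [|lia|lia].
  apply/same_blockP => i ci; have /same_blockP/(_ _ ci) := s; rewrite /=; lia.
have [k1 e1] := one; have [k2 e2] := rest.
exists (fun j => k2 j + k1 j).
have -> : Cvec c - Cvec d = (Cvec c - Cvec d') + (Cvec d' - Cvec d) by rewrite addrA subrK.
rewrite et e1 e2 -big_split; apply: eq_bigr => j _.
by rewrite intrD scalerDl.
Qed.

End Roots.

(** * From the affine Weyl group to loops *)

Section Affine.
Variables (R : realType) (n : nat) (n_gt0 : (0 < n)%N).
Local Notation V := 'rV[R]_n.
Local Notation N := (Posz (n + n)).
Local Notation Cvec := (@Cvec R n).
Local Notation dot := (@dot R n).
Local Notation loop := {ffun 'I_(n + n) -> int}.
Local Notation act := (@Defs.act R n).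
Implicit Types (c d e p q j k : Cn n) (u v : V) (w : {perm Cn n}) (x y : affW R n)
  (X : loop) (m r t : int).

Let N_gt0 : 0 < N. Proof. lia. Qed.

Lemma weylP w : w \in weyl n -> forall c, w (rev_ord c) = rev_ord (w c).
Proof. by rewrite inE => /forallP h c; apply/eqP. Qed.

Lemma act_dot w v c : w \in weyl n -> dot (act w v) (Cvec (w c)) = dot v (Cvec c).
Proof.
move=> /weylP wW; rewrite /Defs.act dot_suml {2}/Defs.dot; apply: eq_bigr => s _.
rewrite dotZl dot_Cvec -wW !(inj_eq perm_inj) -dot_Cvec.
by rewrite Cvec_lshift dot_eps.
Qed.

Lemma act_Cvec w c : w \in weyl n -> act w (Cvec c) = Cvec (w c).
Proof.
move=> wW; apply: dot_ext => d; rewrite -(permKV w d) act_dot //.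
by rewrite !dot_Cvec -(weylP wW) !(inj_eq perm_inj).
Qed.

Lemma actB w u v : w \in weyl n -> act w (u - v) = act w u - act w v.
Proof.
move=> wW; apply: dot_ext => d; rewrite -(permKV w d).
by rewrite dotDl dotNl !act_dot // dotDl dotNl.
Qed.

(** The pairing is an integer on the coroot lattice; the floor only makes it
    an [int]. *)
Definition xi v c : int := Num.floor (dot v (Cvec c)).

Lemma lattice_xi v c : coroot_lattice v -> dot v (Cvec c) = (xi v c)%:~R.
Proof.
move=> [k ->]; rewrite /xi; set u := dot _ _.
suff : u \is a Num.int by move=> h; rewrite floorK.
rewrite /u dot_suml rpred_sum // => i _; rewrite dotZl rpredM ?intr_int //.
have int01 (b : bool) : (b%:R : R) \is a Num.int by case: b; rewrite ?rpred0 ?rpred1.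
have eps_int (s : nat) : dot (eps R n s) (Cvec c) \is a Num.int.
  have aux (t : 'I_n) : dot (eps R n s) (eps R n t) \is a Num.int.
    by rewrite dotC dot_eps mxE.
  have [t [->|->]] := Cn_cases c; rewrite ?Cvec_rev Cvec_lshift ?dotNr ?rpredN; exact: aux.
by rewrite coroot_simple_root dotDl dotNl rpredB.
Qed.

Lemma int_lattice v : (forall s, v 0 s \is a Num.int) -> coroot_lattice v.
Proof.
move=> h; exists (fun i => \sum_(t < n | (t <= i)%N) Num.floor (v 0 t)).
have fK s : (Num.floor (v 0 s))%:~R = v 0 s by rewrite floorK.
apply/rowP => s; rewrite summxE.
under eq_bigr => i _ do rewrite coroot_simple_root !mxE mulrBr.
rewrite sumrB (bigD1 s) //= eqxx mulr1 [X in _ + X - _]big1 ?addr0; last first.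
  by move=> i si; rewrite (inj_eq val_inj) eq_sym (negPf si) mulr0.
have [s0|s0] := posnP s.
  rewrite [X in _ - X]big1 ?subr0; last by move=> i _; rewrite s0 mulr0.
  rewrite (bigD1 s) //= big1 ?addr0 ?fK // => t /andP[ts].
  by rewrite -val_eqE /= => ts'; exfalso; lia.
have hs : (s.-1 < n)%N by have := ltn_ord s; lia.
rewrite [X in _ - X](bigD1 (Ordinal hs)) //= prednK // eqxx mulr1 [X in _ - (_
  + X)]big1 ?addr0; last first.
  move=> i; rewrite -val_eqE /= => si.
  have -> : (nat_of_ord s == i.+1) = false by lia.
  by rewrite mulr0.
rewrite (bigD1 s) //= -[LHS]fK -intrB; congr (_%:~R).
rewrite -[LHS]addr0 -addrA; congr (_ + _); apply/esym/eqP; rewrite subr_eq0; apply/eqP.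
by apply: eq_bigl => t; rewrite -val_eqE /=; lia.
Qed.

Lemma xi_rev v c : coroot_lattice v -> xi v (rev_ord c) = - xi v c.
Proof.
move=> lv; have := lattice_xi (rev_ord c) lv.
rewrite Cvec_rev dotNr (lattice_xi _ lv) -intrN => /eqP.
by rewrite eqr_int => /eqP.
Qed.

Definition loop_of x : loop := [ffun p => (x.1 p)%:Z + N * xi x.2 p].

Lemma loop_ofE x p : loop_of x p = (x.1 p)%:Z + N * xi x.2 p.
Proof. by rewrite ffunE. Qed.

Lemma loop_symm x : in_Waf x -> symm (loop_of x).
Proof.
move=> [wW lx] p; rewrite !loop_ofE xi_rev // (weylP wW) /=.
by have := ltn_ord (x.1 p); lia.
Qed.

Lemma value_eq (c d : Cn n) t : c%:Z = d%:Z + N * t -> c = d /\ t = 0.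
Proof.
move=> e; have hc := ltn_ord c; have hd := ltn_ord d.
have t0 : t = 0.
  case: (ltrgtP t 0) => // ht.
    have : N * t <= N * -1 by apply: ler_wpM2l; lia.
    by lia.
  have : N * 1 <= N * t by apply: ler_wpM2l; lia.
  by lia.
by split=> //; apply: val_inj => /=; move: e; rewrite t0; lia.
Qed.

Lemma loop_inj x : residue_inj (loop_of x).
Proof.
move=> p q t; rewrite !loop_ofE => e; apply: (@perm_inj _ x.1).
by have [] := @value_eq (x.1 p) (x.1 q) (xi x.2 q + t - xi x.2 p) ltac:(lia).
Qed.

Lemma loop_of_inj x y : in_Waf x -> in_Waf y -> loop_of x = loop_of y -> x = y.
Proof.
case: x y => [w v] [w' v'] [_ /= lv] [_ /= lv'] e.
have ep p : w p = w' p /\ xi v p = xi v' p.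
  have := congr1 (fun X : loop => X p) e; rewrite !loop_ofE /= => ep.
  have [] := @value_eq (w p) (w' p) (xi v' p - xi v p) ltac:(lia).
  by move=> -> ?; split=> //; lia.
congr (_, _); first by apply/permP => p; case: (ep p).
by apply: dot_ext => c; rewrite !lattice_xi //; case: (ep c) => _ ->.
Qed.

Lemma aff_act_Cvec x p q m : in_Waf x ->
  aff_act x (Cvec p - Cvec q, m%:~R)
  = (Cvec (x.1 p) - Cvec (x.1 q), (m - (xi x.2 p - xi x.2 q))%:~R).
Proof.
move=> [wW lx]; rewrite /aff_act /= actB // !act_Cvec //; congr (_, _).
by rewrite dotDr dotNr !(lattice_xi _ lx) -!intrB.
Qed.

Lemma aff_pos_loop x p q m : in_Waf x -> p != q ->
  aff_pos (aff_act x (Cvec p - Cvec q, m%:~R)) <-> loop_of x p < loop_of x q + N * m.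
Proof.
move=> xW pq; rewrite aff_act_Cvec // aff_posP ?(inj_eq perm_inj) //.
by rewrite !loop_ofE; split; lia.
Qed.

(** For [p < q] in one block, the roots [Cvec p - Cvec q] and
    [Cvec q - Cvec p + delta] say that [X p < X q] and [X q < X p + N]; the other
    positive affine roots of [J] follow. *)
Lemma in_WJafP J x : in_WJaf J x <-> in_Waf x /\ sorted_loop (cutJ J) (loop_of x).
Proof.
split=> [[xW pos]|[xW sorted]]; split=> //.
  move=> p q pq spq; have npq : p != q by rewrite -val_eqE /= ltn_eqF.
  have nqp : q != p by rewrite eq_sym.
  have h1 : loop_of x p < loop_of x q + N * 0.
    rewrite -aff_pos_loop //; apply: pos; left; split => //=.
      exact/rootsJP.
    by rewrite pos_rootsP.
  have h2 : loop_of x q < loop_of x p + N * 1.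
    rewrite -aff_pos_loop //; apply: pos; right; split => //=.
    by apply/rootsJP => //; rewrite same_block_sym.
  by apply: flr_eq => //; lia.
move=> [a b] h.
have {h} [p [q [m [pq -> -> spq]]]] : exists p q m, [/\ p != q, a = Cvec p - Cvec q, b = m%:~R,
     same_block (cutJ J) p q & (p < q)%N /\ m = 0 \/ 0 < m].
  case: h => /= -[hJ h1 h2].
    have [p [q [pq ea]]] := rootsP (hJ.1); rewrite ea in hJ h1.
    exists p, q, 0; split=> //; first by apply/(rootsJP R J pq).
    by left; rewrite -(pos_rootsP R).
  have [p [q [pq ea]]] := rootsP (hJ.1); rewrite ea in hJ.
  exists p, q, (Num.floor b); rewrite floorK //; split=> //; first by apply/(rootsJP R J pq).
  by right; rewrite -(ltr0z R) floorK.
rewrite aff_pos_loop // => hm.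
have X_neq := @loop_inj x p q.
case: (ltngtP p q) => lt; last by move: pq; rewrite -val_eqE /= lt eqxx.
  have := flr_bounds N_gt0 (loop_of x p) (loop_of x q); rewrite (sorted p q) // => hb.
  have ne : loop_of x p != loop_of x q.
    by apply: contraNneq pq => e; apply/eqP/(X_neq 0); lia.
  case: hm => [[_ ->]|m0]; first by lia.
  have : N * 1 <= N * m by apply: ler_wpM2l; lia.
  by lia.
have := flr_bounds N_gt0 (loop_of x q) (loop_of x p); rewrite (sorted q p) //;
  last by rewrite same_block_sym.
case: hm => [[]|m0]; first by lia.
have : N * 1 <= N * m by apply: ler_wpM2l; lia.
by lia.
Qed.

End Affine.

(** * Reflections are symmetric exchanges *)

Section Reflections.
Variables (R : realType) (n : nat) (n_gt0 : (0 < n)%N).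
Local Notation V := 'rV[R]_n.
Local Notation N := (Posz (n + n)).
Local Notation Cvec := (@Cvec R n).
Local Notation dot := (@dot R n).
Local Notation loop := {ffun 'I_(n + n) -> int}.
Local Notation act := (@Defs.act R n).
Implicit Types (c d e p q j k : Cn n) (u v : V) (w : {perm Cn n}) (x y : affW R n)
  (X : loop) (m r t : int).

Let N_gt0 : 0 < N. Proof. lia. Qed.

(** The reflection in the root [Cvec c - Cvec d]. *)
Definition root_swap c d e : Cn n :=
  if e == c then d else if e == d then c else
  if e == rev_ord c then rev_ord d else if e == rev_ord d then rev_ord c else e.

Lemma rev_eqF c : (rev_ord c == c) = false.
Proof. exact/negbTE/rev_neq. Qed.

Lemma root_swap_rev c d e : c != d -> root_swap c d (rev_ord e) = rev_ord (root_swap c d e).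
Proof.
move=> cd; rewrite /root_swap !(inj_eq rev_ord_inj) !rev_eq.
case: (eqVneq e c) => [->|ec].
  by rewrite ![c == rev_ord _]eq_sym rev_eqF; case: eqVneq => // <-; rewrite rev_ordK.
case: (eqVneq e d) => [->|ed].
  by rewrite ![d == rev_ord _]eq_sym rev_eqF; case: eqVneq => // <-; rewrite rev_ordK.
case: (eqVneq e (rev_ord c)) => [_|ec']; first by rewrite rev_ordK.
by case: (eqVneq e (rev_ord d)) => [_|ed']; first by rewrite rev_ordK.
Qed.

Lemma root_swapK c d : c != d -> involutive (root_swap c d).
Proof.
move=> cd e; rewrite {2}/root_swap.
case: (eqVneq e c) => [->|ec].
  by rewrite /root_swap eqxx; case: eqVneq => // ->.
case: (eqVneq e d) => [->|ed]; first by rewrite /root_swap eqxx.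
case: (eqVneq e (rev_ord c)) => [->|ec'].
  by rewrite root_swap_rev // /root_swap eqxx; case: eqVneq => // ->.
case: (eqVneq e (rev_ord d)) => [->|ed']; first by rewrite root_swap_rev // /root_swap eqxx.
by rewrite /root_swap (negPf ec) (negPf ed) (negPf ec') (negPf ed').
Qed.

(** The pairing of [Cvec e] with the coroot of [Cvec c - Cvec d]. A long
    root is twice its coroot, whence the case distinction. *)
Definition pairing c d e : int :=
  if d == rev_ord c then (c == e)%:Z - (c == rev_ord e)%:Z else
  (c == e)%:Z - (c == rev_ord e)%:Z - ((d == e)%:Z - (d == rev_ord e)%:Z).

Lemma dot_coroot c d e : c != d ->
  dot (coroot (Cvec c - Cvec d)) (Cvec e) = (pairing c d e)%:~R.
Proof.
move=> cd; rewrite /coroot dotZl.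
have dE f : dot (Cvec f) (Cvec e) = ((f == e)%:Z - (f == rev_ord e)%:Z)%:~R.
  by rewrite dot_Cvec intrB.
rewrite /pairing; case: eqVneq => [->|dc].
  rewrite Cvec_rev opprK -mulr2n -scaler_nat !dotZl dotC dotZl dE dot_Cvec eqxx.
  rewrite [c == rev_ord c]eq_sym rev_eqF subr0 mulr1 mulrA; set z := (_)%:~R.
  by rewrite invfM mulrA divff ?mul1r ?mulVf ?mul1r ?pnatr_eq0.
have norm2 : dot (Cvec c - Cvec d) (Cvec c - Cvec d) = 2.
  rewrite !(dotDl, dotDr, dotNl, dotNr) !dot_Cvec !eqxx.
  have -> : (d == c) = false by rewrite eq_sym (negPf cd).
  have -> : (c == rev_ord c) = false by rewrite eq_sym rev_eqF.
  have -> : (d == rev_ord d) = false by rewrite eq_sym rev_eqF.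
  have -> : (c == rev_ord d) = false by rewrite -rev_eq eq_sym (negPf dc).
  by rewrite (negPf cd) (negPf dc) !(subr0, subrr, oppr0, addr0, sub0r, opprK).
by rewrite norm2 divff ?pnatr_eq0 // mul1r dotDl dotNl !dE -intrB.
Qed.

Lemma pairing_cases c d e : c != d ->
  [\/ [/\ e = c, root_swap c d e = d & pairing c d e = 1],
      [/\ e = d, root_swap c d e = c & pairing c d e = -1],
      [/\ e = rev_ord c, d != rev_ord c, root_swap c d e = rev_ord d & pairing c d e = -1] |
      [/\ e = rev_ord d, d != rev_ord c, root_swap c d e = rev_ord c & pairing c d e = 1]]
  \/ [/\ e != c, e != d, e != rev_ord c & e != rev_ord d]
     /\ root_swap c d e = e /\ pairing c d e = 0.
Proof.
move=> cd; have cd' := negPf cd; have dc' : (d == c) = false by rewrite eq_sym.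
rewrite /root_swap /pairing.
case: (eqVneq e c) => [->|ec].
  left; apply: Or41; split=> //; rewrite ?eqxx [c == rev_ord c]eq_sym rev_eqF ?dc'.
  by case: (eqVneq d (rev_ord c)) => _.
case: (eqVneq e d) => [->|ed].
  left; apply: Or42; split=> //; rewrite ?eqxx ?cd' [d == rev_ord d]eq_sym rev_eqF.
  case: (eqVneq d (rev_ord c)) => [->|dc]; first by rewrite rev_ordK ?eqxx.
  by rewrite [c == _]eq_sym rev_eq (negPf dc).
case: (eqVneq e (rev_ord c)) => [e1|ec'].
  have dc : d != rev_ord c by apply: contraNneq ed => ->; rewrite e1.
  left; apply: Or43; split=> //; by rewrite e1 rev_ordK ?eqxx ?(negPf dc) ?dc'.
case: (eqVneq e (rev_ord d)) => [e1|ed'].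
  have dc : d != rev_ord c.
    by apply: contraNneq ec => dc; rewrite e1 dc rev_ordK.
  left; apply: Or44; split=> //; by rewrite e1 rev_ordK ?eqxx ?(negPf dc) ?cd'.
right; split=> //; split=> //.
rewrite ![_ == rev_ord e]eq_sym !rev_eq (negPf ec') (negPf ed').
by case: ifP.
Qed.

Lemma refl_val c d e : c != d ->
  reflV (Cvec c - Cvec d) (Cvec e) = Cvec (root_swap c d e).
Proof.
move=> cd; rewrite /reflV dot_coroot //.
case: (pairing_cases e cd) => [[[-> -> ->]|[-> -> ->]|[-> _ -> ->]|[-> _ -> ->]]|[_ [-> ->]]].
- by rewrite scale1r opprB addrC subrK.
- by rewrite scaleN1r opprK addrC subrK.
- by rewrite scaleN1r opprK !Cvec_rev addrA addNr sub0r.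
- by rewrite scale1r opprB !Cvec_rev addrA addNr sub0r.
- by rewrite scale0r subr0.
Qed.

Lemma Cvec_inj : injective Cvec.
Proof.
move=> c d e; have := dot_Cvec R c d; rewrite -e dot_Cvec eqxx eq_sym rev_eqF subr0.
case: (eqVneq c d) => // _ /esym/eqP; rewrite sub0r -subr_eq0 -opprD oppr_eq0 -natrD pnatr_eq0.
by rewrite addn1.
Qed.

Lemma refl_root_swap c d e : c != d -> refl (Cvec c - Cvec d) e = root_swap c d e.
Proof.
move=> cd; rewrite /refl; case: pickP => [w /forallP h|none] /=.
  by apply: Cvec_inj; have /eqP -> := h e; rewrite refl_val.
have := none (perm (can_inj (root_swapK cd))) => /negbT/forallPn[f].
by rewrite permE refl_val ?eqxx.
Qed.

(** Left multiplication by a reflection acts on values; seen from the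
    positions that carry these values, it is a symmetric exchange. *)
Lemma aff_refl_loop x c d m (y := affM (aff_refl (Cvec c - Cvec d, m%:~R)) x)
    (j := (x.1^-1)%g c) (k := (x.1^-1)%g d) :
  in_Waf x -> c != d -> in_Waf y /\
  loop_of y = sym_exch (loop_of x) j k (m + xi x.2 j - xi x.2 k).
Proof.
move=> [wW lx] cd.
have wj : x.1 j = c by rewrite permKV.
have wk : x.1 k = d by rewrite permKV.
have y1 p : y.1 p = root_swap c d (x.1 p) by rewrite /= permM refl_root_swap.
have wV : (x.1^-1)%g \in weyl n.
  rewrite inE; apply/forallP => p; apply/eqP/(@perm_inj _ x.1).
  by rewrite (weylP wW) !permKV.
have y2 p : dot y.2 (Cvec p) = (m * pairing c d (x.1 p) + xi x.2 p)%:~R.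
  rewrite /= dotDl -{1}(permK x.1 p) act_dot // dotZl dot_coroot //.
  by rewrite (lattice_xi _ lx) intrD intrM.
have xiy p : xi y.2 p = m * pairing c d (x.1 p) + xi x.2 p.
  by rewrite {1}/xi y2 intrKfloor.
have yW : in_Waf y.
  split; first by rewrite inE; apply/forallP => p; rewrite !y1 (weylP wW) root_swap_rev.
  by apply: (int_lattice n_gt0) => s; rewrite -dot_eps dotC -Cvec_lshift y2 intr_int.
split=> //; apply: loop_ext => p; rewrite loop_ofE y1 xiy !ffunE.
have wr q f : x.1 q = rev_ord f -> q = rev_ord ((x.1^-1)%g f).
  by move=> e; apply: (@perm_inj _ x.1); rewrite (weylP wW) permKV.
have wi q f : x.1 q = f -> q = (x.1^-1)%g f by move=> <-; rewrite permK.
have jk : j != k by rewrite (inj_eq perm_inj).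
have kj' : (k == j) = false by rewrite eq_sym (negPf jk).
have revjk : d != rev_ord c -> (rev_ord j == k) = false.
  by move=> dc; apply/negbTE; apply: contraNneq dc => e; rewrite -wk -e (weylP wW) wj.
case: (pairing_cases (x.1 p) cd) => [[[e -> ->]|[e -> ->]|[e dc -> ->]|[e dc
  -> ->]]|[[n1 n2 n3 n4] [-> ->]]].
- by rewrite (wi _ _ e) -/j eqxx wk; lia.
- by rewrite (wi _ _ e) -/k eqxx kj' wj; lia.
- rewrite (wr _ _ e) -/j rev_eqF revjk // eqxx !xi_rev // (weylP wW) wk; lia.
- rewrite (wr _ _ e) -/k rev_eqF rev_eq [k == _]eq_sym revjk // (inj_eq rev_ord_inj) kj' eqxx.
  by rewrite !xi_rev // (weylP wW) wj; lia.
- have m1 q f : x.1 q = f -> x.1 p != f -> (p == q) = false.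
    by move=> eq ne; apply/negbTE; apply: contraNneq ne => ->; rewrite eq.
  rewrite (m1 _ _ wj n1) (m1 _ _ wk n2).
  rewrite (m1 (rev_ord j) (rev_ord c)) ?(weylP wW) ?wj //.
  rewrite (m1 (rev_ord k) (rev_ord d)) ?(weylP wW) ?wk //.
  by rewrite mulr0 add0r.
Qed.

End Reflections.

(** * The length function of the Weyl group *)

Section WeylLength.
Variables (R : realType) (n : nat) (n_ge2 : (2 <= n)%N).
Local Notation V := 'rV[R]_n.
Local Notation N := (Posz (n + n)).
Local Notation Cvec := (@Cvec R n).
Local Notation dot := (@dot R n).
Local Notation loop := {ffun 'I_(n + n) -> int}.
Local Notation fl := (flr N).
Implicit Types (c d e p q j k : Cn n) (u v : V) (w : {perm Cn n}) (x y : affW R n)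
  (X : loop) (m r t : int).

Let n_gt0 : (0 < n)%N. Proof. exact: ltnW. Qed.
Let N_gt0 : 0 < N. Proof. lia. Qed.

(** The loop of [w] with trivial translation part, so that the results on
    exchanges also serve for the finite Weyl group. *)
Definition perm_loop w : loop := [ffun p => (w p)%:Z].

Lemma perm_loopE w p : perm_loop w p = (w p)%:Z.
Proof. by rewrite ffunE. Qed.

Lemma perm_loop_symm w : w \in weyl n -> symm (perm_loop w).
Proof.
move=> wW p; rewrite !perm_loopE (weylP wW) /=.
by have := ltn_ord (w p); lia.
Qed.

Lemma perm_loop_inj w : residue_inj (perm_loop w).
Proof.
by move=> p q t; rewrite !perm_loopE => /(value_eq n_gt0)[/perm_inj].
Qed.

Lemma succ_lt (i : 'I_n) : (i.+1 < n + n)%N.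
Proof. by have := ltn_ord i; lia. Qed.

Definition succ_pos (i : 'I_n) : Cn n := Ordinal (succ_lt i).

Lemma lshift_succ (i : 'I_n) : lshift n i != succ_pos i.
Proof. by rewrite -val_eqE /=; lia. Qed.

(** Multiplying by it on the left in the convention of [perm] exchanges two
    neighbouring positions. *)
Definition simple_refl (i : 'I_n) : {perm Cn n} := refl (simple_root R i).

Lemma simple_reflE i p : simple_refl i p = root_swap (lshift n i) (succ_pos i) p.
Proof.
rewrite /simple_refl (@simple_root_Cvec _ _ i (lshift n i) (succ_pos i)) //.
exact/refl_root_swap/lshift_succ.
Qed.

Lemma simple_refl_weyl i : simple_refl i \in weyl n.
Proof.
rewrite inE; apply/forallP => p; rewrite !simple_reflE root_swap_rev //; exact: lshift_succ.
Qed.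

Lemma weylM w1 w2 : w1 \in weyl n -> w2 \in weyl n -> (w1 * w2)%g \in weyl n.
Proof.
move=> h1 h2; rewrite inE; apply/forallP => p.
by rewrite !permM (weylP h1) (weylP h2).
Qed.

Lemma simple_reflK i w : (simple_refl i * (simple_refl i * w))%g = w.
Proof.
by apply/permP => p; rewrite !permM !simple_reflE root_swapK // lshift_succ.
Qed.

Lemma perm_loop_simple_refl i w :
  perm_loop (simple_refl i * w)%g = sym_exch (perm_loop w) (lshift n i) (succ_pos i) 0.
Proof.
apply: loop_ext => p; rewrite perm_loopE permM simple_reflE !ffunE /root_swap mulr0 ?subr0
  ?addr0.
by do 4!(case: ifP => _ //).
Qed.

Lemma flr_le0 (a b : int) : 0 <= a -> b < N -> fl a b <= 0.
Proof.
move=> a0 bN; have := flr_bounds N_gt0 a b; case: (lerP (fl a b) 0) => // h.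
have : N * 1 <= N * fl a b by apply: ler_wpM2l; lia.
by lia.
Qed.

Lemma flr_geN1 (a b : int) : 0 <= b -> a <= N -> -1 <= fl a b.
Proof. by move=> b0 aN; rewrite flr_ge //; lia. Qed.

Lemma len2_simple_refl i w : w \in weyl n -> (w (lshift n i) < w (succ_pos i))%N ->
  len2 (perm_loop (simple_refl i * w)%g) = len2 (perm_loop w) + 2.
Proof.
move=> wW lt; rewrite perm_loop_simple_refl.
have sy := perm_loop_symm wW; have ij := @perm_loop_inj w.
have up : perm_loop w (lshift n i) < perm_loop w (succ_pos i)
  + N * 0 < perm_loop w (lshift n i) + N.
  by rewrite !perm_loopE; have := ltn_ord (w (succ_pos i)); lia.
have hi := ltn_ord i.
case: (eqVneq (succ_pos i) (rev_ord (lshift n i))) => [e|ne].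
  rewrite e; apply: len2_cover_rev; rewrite -?e //.
  by move=> l /=; lia.
rewrite -val_eqE /= in ne.
by apply: len2_cover; rewrite -?val_eqE //=; try lia; move=> l; lia.
Qed.

Lemma len2_simple_refl_cases i w : w \in weyl n ->
  if (w (lshift n i) < w (succ_pos i))%N
  then len2 (perm_loop (simple_refl i * w)%g) = len2 (perm_loop w) + 2
  else len2 (perm_loop w) = len2 (perm_loop (simple_refl i * w)%g) + 2.
Proof.
move=> wW; case: ltnP => h; first exact: len2_simple_refl.
have ne : w (lshift n i) != w (succ_pos i) by rewrite (inj_eq perm_inj) lshift_succ.
have := @len2_simple_refl i (simple_refl i * w)%g (weylM (simple_refl_weyl i) wW);
  rewrite simple_reflK; apply.
rewrite !permM !simple_reflE /root_swap !eqxx [succ_pos i == _]eq_sym (negPf (lshift_succ i)).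
by rewrite ltn_neqAle eq_sym ne.
Qed.

Lemma sum_const (c : int) : \sum_(p < n + n) c = c * N.
Proof. by rewrite sumr_const card_ord -mulr_natr; congr (_ * _); rewrite natz. Qed.

Lemma len2_perm_bounds w : 0 <= len2 (perm_loop w) <= (n + n)%:Z * (n + n)%:Z + n%:Z.
Proof.
have b p q : -1 <= fl (perm_loop w p) (perm_loop w q) <= 0.
  rewrite !perm_loopE; have := ltn_ord (w p); have := ltn_ord (w q) => *.
  by rewrite flr_le0 ?flr_geN1 //; lia.
have sA : - (N * N) <= \sum_(p < n + n) \sum_(q < n + n)
    (if (p < q)%N then fl (perm_loop w p) (perm_loop w q) else 0) <= 0.
  have e : - (N * N) = \sum_(p < n + n) \sum_(q < n + n) (-1 : int).
    under eq_bigr => p _ do rewrite sum_const.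
    by rewrite sum_const mulN1r mulNr.
  apply/andP; split.
    rewrite e; apply: ler_sum => p _; apply: ler_sum => q _.
    by case: ifP => _ //; case/andP: (b p q).
  apply: sumr_le0 => p _; apply: sumr_le0 => q _.
  by case: ifP => _ //; case/andP: (b p q).
have s0 : - n%:Z <= \sum_(p < n + n | (p < n)%N)
    fl (perm_loop w p) (perm_loop w (rev_ord p)) <= 0.
  have e : - n%:Z = \sum_(p < n + n | (p < n)%N) (-1 : int).
    by rewrite sum_below_const ?leq_addr //; lia.
  apply/andP; split.
    by rewrite e; apply: ler_sum => p _; case/andP: (b p (rev_ord p)).
  by apply: sumr_le0 => p _; case/andP: (b p (rev_ord p)).
move: sA s0; rewrite /len2 /lenA /lenC.
by set S := \sum_(_ < _) _; set S' := \sum_(_ < _ | _) _; lia.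
Qed.

Lemma len2_perm1 : len2 (perm_loop 1%g) = 0.
Proof.
have z p q : (p < q)%N -> fl (perm_loop 1%g p) (perm_loop 1%g q) = 0.
  by move=> pq; apply: flr_eq => //; rewrite !perm_loopE !perm1; have := ltn_ord q; lia.
rewrite /len2 /lenA /lenC big1 ?big1 ?oppr0 // => p.
  by move=> pn; apply: z => /=; lia.
by move=> _; apply: big1 => q _; case: ifP => // /z.
Qed.

(** By symmetry there is no descent in the second half either, so [w] is
    increasing. *)
Lemma weyl_no_descent w : w \in weyl n ->
  (forall i, (w (lshift n i) < w (succ_pos i))%N) -> w = 1%g.
Proof.
move=> wW asc.
have step p q : q = p.+1 :> nat -> (w p < w q)%N.
  move=> e; case: (ltnP p n) => pn.
    have := asc (Ordinal pn).
    have -> : lshift n (Ordinal pn) = p by apply: val_inj.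
    by have -> : succ_pos (Ordinal pn) = q by apply: val_inj.
  have hq := ltn_ord q.
  have rn : (rev_ord q < n)%N by rewrite /=; lia.
  have := asc (Ordinal rn).
  have -> : lshift n (Ordinal rn) = rev_ord q by apply: val_inj.
  have -> : succ_pos (Ordinal rn) = rev_ord p by apply: val_inj => /=; lia.
  by rewrite !(weylP wW) /=; have := ltn_ord (w p); have := ltn_ord (w q); lia.
have ge (k : nat) : forall p, p = k :> nat -> (k <= w p)%N.
  elim: k => [//|k IH] p ep.
  have kN : (k < n + n)%N by have := ltn_ord p; lia.
  by have := IH (Ordinal kN) erefl; have := step (Ordinal kN) p ep; lia.
apply/permP => p; apply: val_inj; rewrite perm1.
have := ge p p erefl; have := ge (rev_ord p) (rev_ord p) erefl.
by rewrite (weylP wW) /=; have := ltn_ord p; have := ltn_ord (w p); lia.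
Qed.

Lemma word_len2 (s : seq 'I_n) : (\prod_(i <- s) simple_refl i)%g \in weyl n /\
  len2 (perm_loop (\prod_(i <- s) simple_refl i)%g) <= 2 * (size s)%:Z.
Proof.
elim: s => [|i s [sW IH]].
  by rewrite big_nil len2_perm1; split=> //; rewrite inE; apply/forallP => p; rewrite !perm1.
rewrite big_cons; move: sW IH; set W := (\prod_(_ <- _) _)%g => sW IH.
split; first exact: weylM (simple_refl_weyl i) sW.
have := len2_simple_refl_cases i sW; rewrite [size _]/=.
by case: ifP => _ e; lia.
Qed.

Lemma reduced_word w : w \in weyl n -> exists2 s : seq 'I_n,
  w = (\prod_(i <- s) simple_refl i)%g & len2 (perm_loop w) = 2 * (size s)%:Z.
Proof.
have [M] := ubnP `|len2 (perm_loop w)|%N; elim: M w => // M IH w hM wW.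
case: (boolP [forall i, (w (lshift n i) < w (succ_pos i))%N]) => [/forallP asc|].
  by exists [::]; rewrite ?big_nil ?(weyl_no_descent wW asc) ?len2_perm1.
rewrite negb_forall => /existsP[i /negbTE des].
have := len2_simple_refl_cases i wW; rewrite des => e.
have /andP[ge0 _] := len2_perm_bounds (simple_refl i * w)%g.
have [s es ls] := IH (simple_refl i * w)%g ltac:(lia) (weylM (simple_refl_weyl i) wW).
exists (i :: s); first by rewrite big_cons -es simple_reflK.
by rewrite e ls /=; lia.
Qed.

(** It implies that the length stays below the number of permutations, the
    bound in the search that defines [weyl_length]. *)
Lemma fact_bound (k : nat) : (4 <= k)%N -> (k * k + k < 2 * k`!)%N.
Proof.
elim: k => // k IH; rewrite leq_eqVlt => /orP[/eqP <- //|k4].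
have h : (k.+1 * (k * k + k) < k.+1 * (2 * k`!))%N by rewrite ltn_pmul2l // IH.
have h' : (k.+1 * (k + 2) <= k.+1 * (k * k + k))%N.
  by rewrite leq_pmul2l //; have : (4 * k <= k * k)%N by [rewrite leq_pmul2r //; lia]; lia.
by rewrite factS; lia.
Qed.

(** A word in simple reflections has at least half as many letters as
    [len2], and sorting by descents reaches this bound. *)
Lemma weyl_lengthE w : w \in weyl n -> 2 * (weyl_length R w)%:Z = len2 (perm_loop w).
Proof.
move=> wW; have [s ws ls] := reduced_word wW.
rewrite ls; congr (2 * Posz _).
pose P (k : nat) := [exists t : k.-tuple 'I_n, w == (\prod_(i <- t) simple_refl i)%g].
have Ps : P (size s) by apply/existsP; exists (in_tuple s); rewrite -ws.
have Pmin (k : nat) : P k -> (size s <= k)%N.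
  move=> /existsP[t /eqP wt]; have [_] := word_len2 t.
  by rewrite -wt ls size_tuple; lia.
rewrite /weyl_length -/P card_Sn.
have sK : (size s < (n + n)`!)%N.
  have := @fact_bound (n + n) ltac:(lia); have := len2_perm_bounds w; rewrite ls.
  by lia.
have hasP : has P (iota 0 (n + n)`!).
  by apply/hasP; exists (size s); rewrite // mem_iota.
apply/eqP; rewrite eqn_leq; apply/andP; split.
  rewrite leqNgt; apply/negP => lt.
  by have := before_find 0%N lt; rewrite nth_iota // Ps.
apply: Pmin; have := nth_find 0%N hasP.
by rewrite nth_iota //; rewrite has_find size_iota in hasP.
Qed.

End WeylLength.

(** * The semi-infinite length *)

Section SiLength.
Variables (R : realType) (n : nat) (n_ge2 : (2 <= n)%N).
Local Notation V := 'rV[R]_n.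
Local Notation N := (Posz (n + n)).
Local Notation Cvec := (@Cvec R n).
Local Notation dot := (@dot R n).
Local Notation loop := {ffun 'I_(n + n) -> int}.
Local Notation fl := (flr N).
Implicit Types (c d e p q j k : Cn n) (u v : V) (w : {perm Cn n}) (x y : affW R n)
  (X : loop) (m r t : int).

Let n_gt0 : (0 < n)%N. Proof. exact: ltnW. Qed.
Let N_gt0 : 0 < N. Proof. lia. Qed.

(** That is, [rho] has the coordinates [n, n - 1, .., 1]. *)
Lemma dot_rho v : 2 * dot v (rho R n) = \sum_(s < n) (v 0 s) *+ (2 * (n - s)).
Proof.
have posE c d : c != d -> [forall i, 0 <= coord (simple_roots R n) i (Cvec c - Cvec d)]
  = (c < d)%N.
  by move=> cd; rewrite -(pos_rootsP R cd) mem_filter roots_Cvec // andbT.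
rewrite /rho dotC dotZl mulrA divff ?pnatr_eq0 // mul1r dot_suml.
pose G (a : V) := if [forall i, 0 <= coord (simple_roots R n) i a] then dot a v else 0.
rewrite /pos_roots big_filter big_mkcond (eq_bigr G) // /Defs.roots big_cat.
have GE c d : c != d -> G (Cvec c - Cvec d) = if (c < d)%N then dot (Cvec c - Cvec d) v else 0.
  by move=> cd; rewrite /G posE.
pose p (s : 'I_n) : Cn n := lshift n s; pose b (s : 'I_n) : Cn n := rev_ord (lshift n s).
have pb (s t : 'I_n) : p s != b t /\ (p s < b t)%N.
  by rewrite -val_eqE /=; have := ltn_ord s; have := ltn_ord t; lia.
have Ep (s : 'I_n) : eps R n s = Cvec (p s) by rewrite Cvec_lshift.
have Eb (s : 'I_n) : - eps R n s = Cvec (b s) by rewrite Cvec_rev Cvec_lshift.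
have de (s : 'I_n) : dot (eps R n s) v = v 0 s by exact: dot_eps.
rewrite !big_allpairs_dep !big_enum /=.
have short (s t : 'I_n) : (s < t)%N ->
  \sum_(a <- [:: eps R n s + eps R n t; eps R n s - eps R n t;
    - (eps R n s + eps R n t); - (eps R n s - eps R n t)]) G a = v 0 s *+ 2.
  move=> st; rewrite !big_cons big_nil.
  have G1 : G (eps R n s + eps R n t) = v 0 s + v 0 t.
    rewrite -[eps R n t]opprK Eb Ep GE; last by have [] := pb s t.
    by have [_ ->] := pb s t; rewrite dotDl dotNl -Eb dotNl opprK -Ep !de.
  have G2 : G (eps R n s - eps R n t) = v 0 s - v 0 t.
    by rewrite !Ep GE -?val_eqE /= ?ltn_eqF // st dotDl dotNl -!Ep !de.
  have G3 : G (- (eps R n s + eps R n t)) = 0.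
    rewrite opprD Eb Ep GE; last by rewrite eq_sym; have [] := pb t s.
    by have [_ h] := pb t s; rewrite ltnNge ltnW.
  have G4 : G (- (eps R n s - eps R n t)) = 0.
    rewrite opprB !Ep GE -?val_eqE /= ?gtn_eqF //.
    by rewrite ltnNge ltnW.
  by rewrite G1 G2 G3 G4 !addr0 addrACA subrr addr0 mulr2n.
have long (s : 'I_n) : \sum_(a <- [:: 2 *: eps R n s; - (2 *: eps R n s)]) G a = v 0 s *+ 2.
  rewrite !big_cons big_nil scaler_nat.
  have G1 : G (eps R n s *+ 2) = v 0 s *+ 2.
    rewrite mulr2n -{2}[eps R n s]opprK Eb Ep GE; last by have [] := pb s s.
    by have [_ ->] := pb s s; rewrite dotDl dotNl -Eb dotNl opprK -Ep !de mulr2n.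
  have G2 : G (- (eps R n s *+ 2)) = 0.
    rewrite mulr2n opprD {1}Eb Ep GE; last by rewrite eq_sym; have [] := pb s s.
    by have [_ h] := pb s s; rewrite ltnNge ltnW.
  by rewrite G1 G2 !addr0.
rewrite (eq_bigr (fun st : 'I_n * 'I_n => v 0 st.1 *+ 2)); last first.
  by move=> [s t]; rewrite inE /= => st; rewrite short.
rewrite [X in _ + X](eq_bigr (fun s : 'I_n => v 0 s *+ 2)); last by move=> s _; exact: long.
rewrite (eq_bigl (fun st : 'I_n * 'I_n => (st.1 < st.2)%N)); last by move=> st; rewrite inE.
rewrite -(pair_big_dep xpredT (fun s t : 'I_n => (s < t)%N) (fun (s t : 'I_n)
  => v 0 s *+ 2)) /=.
rewrite -big_split /=; apply: eq_bigr => s _.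
rewrite sumr_const.
have -> : #|[pred t : 'I_n | (s < t)%N]| = (n - s.+1)%N.
  rewrite -sum1_card /= -(big_mkord (fun t : nat => s < t)%N (fun=> 1%N)).
  rewrite (big_cat_nat (n := s.+1)) //= big_nat_cond big_pred0 ?add0n; last first.
    by move=> i; apply/negbTE/negP => /andP[/andP[_ h]]; rewrite ltnNge -ltnS h.
  rewrite big_nat_cond (eq_bigl (fun i => (s < i < n)%N)); last by move=> i; lia.
  by rewrite -big_nat sum_nat_const_nat muln1.
by rewrite -mulrnA -mulrnDr; congr (_ *+ _); have := ltn_ord s; lia.
Qed.

Lemma sum_above_const p (a : int) : \sum_(q < n + n) (if (p < q)%N then a else 0)
  = a * (N - 1 - p%:Z).
Proof.
have e : \sum_(q < n + n) a = \sum_(q < n + n) (if (p < q)%N then a else 0)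
    + \sum_(q < n + n | (q < p.+1)%N) a.
  rewrite [X in _ + X]big_mkcond -big_split; apply: eq_bigr => q _.
  by rewrite ltnS /=; case: (ltnP p q) => _; rewrite ?addr0 ?add0r.
have := sum_const n a; rewrite e sum_below_const //.
by set S := \sum_(_ < _) _; lia.
Qed.

Lemma sum_rev (f : Cn n -> int) : \sum_p f p = \sum_(s < n) (f (lshift n s)
  + f (rev_ord (lshift n s))).
Proof.
rewrite (bigID (fun p : Cn n => (p < n)%N)) /=.
have -> : \sum_(p < n + n | ~~ (p < n)%N) f p = \sum_(p < n + n | (p < n)%N) f (rev_ord p).
  rewrite (reindex_inj rev_ord_inj); apply: eq_bigl => p /=.
  by have := ltn_ord p; lia.
have narrow (g : Cn n -> int) : \sum_(p < n + n | (p < n)%N) g p = \sum_(s < n) g (lshift n s).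
  rewrite (big_ord_narrow (leq_addr n n)); apply: eq_bigr => s _; congr g.
  exact: val_inj.
by rewrite !narrow -big_split.
Qed.

(** Each pair [p < q] contributes the difference of the [xi]; collecting
    the coefficients of [xi_p] and [xi_(rev_ord p)] gives the coordinates of
    [rho]. *)
Lemma len2_loop x : in_Waf x -> len2 (loop_of x) = len2 (perm_loop x.1)
  + \sum_(s < n) 4 * (xi x.2 (lshift n s) * (n - s)%N%:Z).
Proof.
move=> [_ lx]; set z := xi x.2.
have flE p q : fl (loop_of x p) (loop_of x q) = fl (perm_loop x.1 p) (perm_loop x.1 q)
  + (z q - z p).
  by rewrite !loop_ofE flr_shiftl // flr_shiftr // !perm_loopE -/z; lia.
have eA : lenA (loop_of x) = lenA (perm_loop x.1) + \sum_p z p * (N - 1 - 2 * p%:Z).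
  have swap : \sum_(p < n + n) \sum_(q < n + n) (if (p < q)%N then z q else 0)
    = \sum_(q < n + n) z q * q%:Z.
    rewrite exchange_big; apply: eq_bigr => q _.
    by rewrite -big_mkcond /= sum_below_const // ltnW.
  have drop : \sum_(p < n + n) \sum_(q < n + n) (if (p < q)%N then z p else 0)
    = \sum_(p < n + n) z p * (N - 1 - p%:Z).
    by apply: eq_bigr => p _; rewrite sum_above_const.
  have e : \sum_(p < n + n) \sum_(q < n + n)
      (if (p < q)%N then fl (loop_of x p) (loop_of x q) else 0)
    = \sum_(p < n + n) \sum_(q < n + n)
      (if (p < q)%N then fl (perm_loop x.1 p) (perm_loop x.1 q) else 0)
    + \sum_(p < n + n) \sum_(q < n + n) (if (p < q)%N then z q else 0)
    - \sum_(p < n + n) \sum_(q < n + n) (if (p < q)%N then z p else 0).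
    rewrite -big_split -sumrB; apply: eq_bigr => p _; rewrite -big_split -sumrB;
      apply: eq_bigr => q _ /=.
    by case: ifP => _; rewrite ?flE; lia.
  rewrite /lenA e swap drop.
  have -> : \sum_p z p * (N - 1 - 2 * p%:Z) = \sum_(p < n + n) z p * (N - 1 - p%:Z)
    - \sum_(q < n + n) z q * q%:Z.
    by rewrite -sumrB; apply: eq_bigr => p _; lia.
  by set A := \sum_(_ < _) _; set B := \sum_(_ < _) _; set C := \sum_(_ < _) _; lia.
have e0 : lenC (loop_of x) = lenC (perm_loop x.1) + \sum_(s < n) 2 * z (lshift n s).
  have -> : \sum_(s < n) 2 * z (lshift n s) = \sum_(p < n + n | (p < n)%N) 2 * z p.
    rewrite (big_ord_narrow (leq_addr n n)); apply: eq_bigr => s _; congr (2 * z _).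
    exact: val_inj.
  rewrite /lenC -!sumrN -big_split; apply: eq_bigr => p _ /=.
  by rewrite flE /z xi_rev //; lia.
rewrite /len2 eA e0 sum_rev addrACA; congr (_ + _).
rewrite -big_split; apply: eq_bigr => s _ /=.
by rewrite /z xi_rev //; have := ltn_ord s; nia.
Qed.

Lemma si_lengthE x : in_Waf x -> 2 * si_length x = (len2 (loop_of x))%:~R.
Proof.
move=> xW; have [wW lx] := xW.
rewrite len2_loop // -(weyl_lengthE R n_ge2 wW) intrD intrM /si_length mulrDr.
congr (_ + _); rewrite dot_rho mulr_sumr (raddf_sum (intmul 1)) /=; apply: eq_bigr => s _.
rewrite !intrM -[_ *+ (2 * _)]mulr_natr natrM.
have -> : x.2 0 s = (xi x.2 (lshift n s))%:~R.
  by rewrite -(lattice_xi _ lx) Cvec_lshift dotC dot_eps.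
by rewrite !mulrA; congr (_ * _); rewrite mulrAC -natrM.
Qed.

End SiLength.

(** * Tableaux and prefix counts *)

Section Tableaux.
Variables (R : realType) (n : nat) (n_gt0 : (0 < n)%N).
Local Notation V := 'rV[R]_n.
Local Notation N := (Posz (n + n)).
Local Notation Cvec := (@Cvec R n).
Local Notation loop := {ffun 'I_(n + n) -> int}.
Local Notation fl := (flr N).
Implicit Types (c d e p q j k : Cn n) (v : V) (w : {perm Cn n}) (x y : affW R n).

Let N_gt0 : 0 < N. Proof. lia. Qed.

Definition count_le (T : {set Cn n}) (m : nat) : nat := (\sum_(c in T) (c <= m))%N.

Lemma count_leE (T : {set Cn n}) (m : nat) :
  count (fun c : nat => c <= m)%N [seq val c | c <- enum T] = count_le T m.
Proof.
rewrite -sum1_count big_map big_enum_cond /= /count_le.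
by rewrite big_mkcondr; apply: eq_bigr => c _; case: (_ <= _)%N.
Qed.

(** The passage from entries to counts. *)
Lemma entry_le (T : {set Cn n}) (u m : nat) : (0 < u <= #|T|)%N ->
  (entry T u <= m)%N = (u <= count_le T m)%N.
Proof.
move=> /andP[u0 uT]; rewrite -count_leE /entry.
set s := [seq val c | c <- enum T].
have ss : size s = #|T| by rewrite size_map -cardE.
have srt : path.sorted leq s.
  apply: (subseq_sorted leq_trans _ (iota_sorted 0 (n + n))).
  by rewrite -val_enum_ord map_subseq // enumT filter_subseq.
case: (leqP u (count _ s)) => h.
  have := @nth_count_le _ nat m 0%N s u.-1.
  by apply=> //; rewrite prednK.
apply/negbTE; rewrite -ltnNge.
have := @nth_count_gt _ nat m 0%N s u.-1.
by apply=> //; rewrite ss; apply/andP; split; rewrite -ltnS prednK.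
Qed.

Lemma entry_lt (T : {set Cn n}) (u : nat) : (0 < u <= #|T|)%N -> (entry T u < n + n)%N.
Proof.
move=> /andP[u0 uT]; rewrite /entry.
have : (u.-1 < size (enum T))%N by rewrite -cardE prednK.
case: (enum T) => // c0 s us.
by rewrite (nth_map c0) // ltn_ord.
Qed.

Lemma count_le_max (T : {set Cn n}) : count_le T (n + n).-1 = #|T|.
Proof.
rewrite -sum1_card; apply: eq_bigr => c _.
by have := ltn_ord c; case: leqP => //; lia.
Qed.

Lemma count_le_card (T : {set Cn n}) (m : nat) : (count_le T m <= #|T|)%N.
Proof. by rewrite -sum1_card; apply: leq_sum => c _; apply: leq_b1. Qed.

(** The inequality for [u] is the inequality of counts at the place
    [T'(u + a' - a)]. *)
Lemma CST_leP (k : nat) (T T' : {set Cn n}) (a a' : int) :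
  T \in CST n k -> T' \in CST n k ->
  CST_le k (T, a) (T', a') <->
  (forall m, (m < n + n)%N -> (count_le T' m)%:Z - a' <= (count_le T m)%:Z - a).
Proof.
move=> hT hT'; have cT : #|T| = k by move: hT; rewrite inE => /andP[/eqP].
have cT' : #|T'| = k by move: hT'; rewrite inE => /andP[/eqP].
split=> [[_ _ aa h] m mN|h].
  case: (lerP (count_le T' m)%:Z (a' - a)) => hc; first by lia.
  pose u := absz ((count_le T' m)%:Z - (a' - a))%R.
  have bT' := count_le_card T' m; rewrite cT' in bT'.
  have u0 : (0 < u)%N by rewrite /u; lia.
  have := h u u0 ltac:(rewrite /u; lia).
  have -> : (u + absz (a' - a)%R)%N = count_le T' m by rewrite /u; lia.
  have e' : (entry T' (count_le T' m) <= m)%N by rewrite entry_le // cT' bT' andbT; lia.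
  move=> e; have := leq_trans e e'; rewrite entry_le; first by rewrite /u; lia.
  by rewrite cT u0 /=; rewrite /u; lia.
have aa : a <= a'.
  have := h (n + n).-1 ltac:(lia); rewrite !count_le_max cT cT'; lia.
split=> // u u0 hu.
have hu' : (0 < u + absz (a' - a)%R <= #|T'|)%N by rewrite cT'; lia.
have hu'' : (0 < u <= #|T|)%N by rewrite cT u0 /=; lia.
rewrite entry_le //; have := h _ (entry_lt hu').
have := entry_le (entry T' (u + absz (a' - a)%R)) hu'; rewrite leqnn.
move/esym; move: (count_le T' _) (count_le T _) => b' b; move: aa; clear; lia.
Qed.

Lemma psum_coroot (s t : 'I_n) : psum s (coroot (simple_root R t)) = (s == t)%:R.
Proof.
case: (eqVneq s t) => [<-|st]; last first.
  have h := psum_simple_root R st; rewrite simple_root_coroot psumZ in h.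
  move/eqP: h; rewrite mulf_eq0.
  by case: ifP => _; rewrite ?oner_eq0 ?pnatr_eq0 /= => /eqP.
rewrite coroot_simple_root psumD psumN /psum.
rewrite (bigD1 s) //= mxE eqxx [X in _ + X - _]big1 ?addr0; last first.
  by move=> t' /andP[_ ts]; rewrite mxE (inj_eq val_inj) (negPf ts).
rewrite big1 ?subr0 // => t' ts; rewrite mxE; case: eqP => // e.
by move: ts; rewrite e ltnn.
Qed.

(** Partial sums of coordinates are dual to the simple coroots. *)
Lemma coroot_coef_psum (i : 'I_n) v : coroot_lattice v ->
  (coroot_coef i v)%:~R = psum i v.
Proof.
move=> [k ->]; rewrite coroot_coefE.
rewrite (big_morph _ (psumD i) (_ : psum i 0 = 0)); last by rewrite /psum big1 // => t _;
  rewrite mxE.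
rewrite (bigD1 i) //= psumZ psum_coroot eqxx mulr1 big1 ?addr0 // => t ti.
by rewrite psumZ psum_coroot eq_sym (negPf ti) mulr0.
Qed.

Lemma coroot_coef_xi (i : 'I_n) v : coroot_lattice v ->
  coroot_coef i v = \sum_(p < n + n | (p < i.+1)%N) xi v p.
Proof.
move=> lv; apply: (@intr_inj R); rewrite coroot_coef_psum // (raddf_sum (intmul 1)) /=.
have iN : (i.+1 <= n + n)%N by have := ltn_ord i; lia.
rewrite (big_ord_narrow iN) /psum (big_ord_narrow (ltn_ord i)).
apply: eq_bigr => t _; rewrite -(lattice_xi _ lv) dotC.
have -> : widen_ord iN t = lshift n (widen_ord (ltn_ord i) t) by apply: val_inj.
by rewrite Cvec_lshift dot_eps.
Qed.

Lemma count_le_tab (k : nat) w (m : nat) :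
  count_le (tab k w) m = (\sum_(p < n + n | p < k) (w p <= m))%N.
Proof.
rewrite /count_le /tab big_imset /=; last by move=> p q _ _; apply: perm_inj.
by apply: eq_bigl => p; rewrite inE.
Qed.

Lemma pcount_loop (i : 'I_n) x m : in_Waf x -> (m < n + n)%N ->
  pcount (loop_of x) i.+1 m%:Z
  = (count_le (tab i.+1 x.1) m)%:Z - coroot_coef i x.2 - i.+1%:Z.
Proof.
move=> [wW lx] mN; have iN : (i.+1 <= n + n)%N by have := ltn_ord i; lia.
rewrite coroot_coef_xi // -[i.+1%:Z]mul1r -(sum_below_const 1 iN) //.
rewrite count_le_tab (big_morph Posz PoszD (erefl (Posz 0))) -!sumrB.
apply: eq_bigr => p _; rewrite loop_ofE flr_shiftl //.
have hp := ltn_ord (x.1 p).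
have -> : fl (x.1 p) m = (x.1 p <= m)%N%:Z - 1.
  by apply: flr_eq => //; case: leqP => /=; lia.
by rewrite addrAC.
Qed.

Lemma CST_le_pcount (i : 'I_n) x y : in_Waf x -> in_Waf y ->
  CST_le i.+1 (Y i x) (Y i y) <->
  forall m, pcount (loop_of y) i.+1 m <= pcount (loop_of x) i.+1 m.
Proof.
move=> xW yW; have iN : (i.+1 <= n + n)%N by have := ltn_ord i; lia.
have tx : tab i.+1 x.1 \in CST n i.+1 by apply: tab_CST; [exact: ltn_ord|case: xW].
have ty : tab i.+1 y.1 \in CST n i.+1 by apply: tab_CST; [exact: ltn_ord|case: yW].
rewrite /Y CST_leP //.
split=> h m; last first.
  by move=> mN; have := h m%:Z; rewrite !pcount_loop //; lia.
have [m' e] := excess_ord n_gt0 (loop_of x) (loop_of y) m iN.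
rewrite -subr_ge0 -/(excess _ _ _ _) e subr_ge0 !pcount_loop //.
by have := h m' (ltn_ord m'); lia.
Qed.

End Tableaux.

(** * The comparison theorem *)

Section Conclusion.
Variables (R : realType) (n : nat) (n_ge2 : (2 <= n)%N) (J : {set 'I_n}).
Local Notation N := (Posz (n + n)).
Local Notation Cvec := (@Cvec R n).
Local Notation loop := {ffun 'I_(n + n) -> int}.
Implicit Types (p q j k : Cn n) (x y : affW R n) (X : loop).

Let n_gt0 : (0 < n)%N. Proof. exact: ltnW. Qed.

Lemma cut_leP x y : in_Waf x -> in_Waf y ->
  cut_le (cutJ J) (loop_of x) (loop_of y) <->
  (forall i : 'I_n, i \notin J -> CST_le i.+1 (Y i x) (Y i y)).
Proof.
move=> xW yW; split=> [le i iJ|h].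
  apply/CST_le_pcount => // m; apply: le; first by have := ltn_ord i; lia.
  by apply/or3P/Or33/existsP; exists i; rewrite iJ eqxx.
apply: (cut_le_half n_gt0 (cutJ0 J) (@cutJ_sym n J));
  [exact: loop_symm|exact: loop_symm|exact: loop_inj|exact: loop_inj|].
move=> i iN /or3P[/eqP ->|/eqP e|/existsP[s /andP[sJ e]]] m.
- by rewrite !pcount0.
- by exfalso; lia.
have -> : i = s.+1 by have := ltn_ord s; lia.
by apply: (CST_le_pcount n_gt0 s xW yW).1; apply: h.
Qed.

Lemma sym_exch_opp X j k r : j != k -> sym_exch X j k r = sym_exch X k j (- r).
Proof.
move=> jk; apply: loop_ext => p; rewrite !ffunE mulrN opprK.
case: (eqVneq p j) => [->|pj]; first by rewrite (negPf jk).
case: (eqVneq p k) => // pk.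
case: (eqVneq p (rev_ord j)) => [->|//].
by rewrite (inj_eq rev_ord_inj) (negPf jk).
Qed.

(** If the reflection lowered the value at the smaller position, it would
    raise it the other way round, and the length would go down. *)
Lemma si_cover_cut_le x y : si_cover J x y -> cut_le (cutJ J) (loop_of x) (loop_of y).
Proof.
move=> [xJ yJ [[a b] [pos -> len]]].
have [xW _] := (in_WJafP n_gt0 J x).1 xJ.
have [c [d [m [cd ea eb]]]] : exists c d (m : int), [/\ c != d, a = Cvec c - Cvec d & b
  = m%:~R].
  case: pos => /= -[ha hb]; last first.
    have [c [d [cd ->]]] := rootsP ha; exists c, d, (Num.floor b).
    by rewrite floorK.
  have [c [d [cd ->]]] : exists c d, c != d /\ a = Cvec c - Cvec d.
    by apply: rootsP; move: ha; rewrite mem_filter => /andP[].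
  by exists c, d, 0; rewrite hb.
move: pos len; rewrite ea eb => pos len.
have [yW eY] := aff_refl_loop n_gt0 m xW cd.
set y' := affM _ x in yW eY len *.
move: pos; rewrite aff_posP // => pos.
set j := (x.1^-1)%g c in eY; set k := (x.1^-1)%g d in eY; set r := _ - _ in eY.
have jk : j != k by rewrite (inj_eq perm_inj).
have sX := loop_symm n_gt0 xW; have iX := loop_inj n_gt0 (x := x).
have up : loop_of x j < loop_of x k + N * r.
  by rewrite !loop_ofE !permKV /r; lia.
have elen : len2 (loop_of y') = len2 (loop_of x) + 2.
  apply/eqP; rewrite -(eqr_int R) intrD -!(si_lengthE n_ge2) // len mulrDr.
  by rewrite mulr1.
rewrite eY in elen *; case: (ltngtP j k) => lt; last by move/val_inj/eqP: lt;
  rewrite (negPf jk).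
  by move=> i iN ci m'; apply: pcount_sym_exch_le => //; apply: ltW.
exfalso; rewrite (sym_exch_opp _ _ jk) in elen.
have kj : k != j by rewrite eq_sym.
have := @len2_sym_exch_rise n n_gt0 (sym_exch (loop_of x) k j (- r)) k j (- r)
  (sym_exch_symm n_gt0 (- r) sX kj) (sym_exch_inj n_gt0 (r := - r) iX kj) lt.
rewrite sym_exchK // sym_exch_l sym_exch_r // elen => h.
by have := h ltac:(lia); lia.
Qed.

End Conclusion.

Theorem theorem4p14 (R : realType) (n : nat) (hn : (2 <= n)%N)
    (J : {set 'I_n}) (x y : affW R n)
    (hx : in_WJaf J x) (hy : in_WJaf J y) :
  si_le J x y <->
  (forall i : 'I_n, i \notin J -> CST_le i.+1 (Y i x) (Y i y)).
Proof.
have n_gt0 : (0 < n)%N by apply: ltnW.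
have [xW sx] := (in_WJafP n_gt0 J x).1 hx; have [yW sy] := (in_WJafP n_gt0 J y).1 hy.
rewrite -(cut_leP hn J xW yW); split.
  elim=> [u v uv|u|u v w _ huv _ hvw].
  - exact: si_cover_cut_le uv.
  - by move=> i iN ci m.
  - by move=> i iN ci m; apply: le_trans (hvw i iN ci m) (huv i iN ci m).
have wf (u : affW R n) : in_WJaf J u -> wf_loop (cutJ J) (loop_of u).
  move=> /(in_WJafP n_gt0)[uW su]; split=> //; [exact: loop_symm|exact: loop_inj].
move=> le; have := @cut_le_ind n n_gt0 (cutJ J) (cutJ0 J) (@cutJ_sym n J) (loop_of y)
  (fun X => forall u : affW R n, in_WJaf J u -> loop_of u = X -> si_le J u y) (wf y hy).
move=> ind; apply: (ind _ _ (loop_of x) (wf x hx) le x hx erefl).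
  move=> u hu e; have [uW _] := (in_WJafP n_gt0 J u).1 hu.
  by rewrite (loop_of_inj n_gt0 uW yW e); apply: rt_refl.
move=> X j k r [sX iX _] [jk up sX' _ elen] IH u hu eu.
have [uW _] := (in_WJafP n_gt0 J u).1 hu.
have jk' : u.1 j != u.1 k by rewrite (inj_eq perm_inj) -val_eqE /= ltn_eqF.
have := aff_refl_loop n_gt0 (r - xi u.2 j + xi u.2 k) uW jk'.
set b := (_, _); set v := affM _ _ => -[vW ev].
have {}ev : loop_of v = sym_exch X j k r.
  by rewrite ev !permK eu; congr sym_exch; lia.
have hv : in_WJaf J v by apply/(in_WJafP n_gt0); rewrite ev.
apply: (@rt_trans _ _ _ v); last exact: IH.
apply: rt_step; split=> //; exists b; split=> //.
  rewrite aff_posP //; move: up; rewrite -eu !loop_ofE; lia.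
have e1 := si_lengthE hn vW; have e2 := si_lengthE hn uW.
have : 2 * si_length v = 2 * (si_length u + 1).
  by rewrite [RHS]mulrDr e1 e2 ev eu elen intrD mulr1.
by apply: mulfI; rewrite pnatr_eq0.
Qed.
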